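(* Let $k$ be an algebraically closed field, $Q$ a finite quiver, $I\subset kQ$ an admissible ideal, $B=kQ/I$, $n=\dim_kB$ and $J(B)$ the Jacobson radical of $B$. Let $H_B$ be the group of all $k$-algebra automorphisms of $B$ that fix every vertex of $Q$ (i.e. the corresponding idempotents of $B$). Then $\operatorname{AlgGr}_{n-1}(B)$ is a finite union of $\operatorname{Aut}_k(B)$-orbits if and only if for every pair $(u,v)\in Q_0\times Q_0$ with $u\big(J(B)/J(B)^2\big)v\ne\{0\}$, the projective space $\mathbb P\big((u(J(B)/J(B)^2)v)^*\big)$ is a finite union of $H_B$-orbits.
   Context: Algebras are unital, associative, finite-dimensional over $k$; subalgebras contain the unit. $\operatorname{AlgGr}_m(B)$ is the variety of $m$-dimensional subalgebras of $B$, closed in the Grassmannian $\operatorname{Gr}_m(B)$; the group $\operatorname{Aut}_k(B)$ of $k$-algebra automorphisms acts on it by $A\mapsto\phi(A)$. $kQ$ is the path algebra, $J(Q)$ its two-sided ideal generated by the arrows, and $I$ is admissible if $J(Q)^2\supset I\supset J(Q)^\ell$ for some $\ell\ge2$. $Q_0$ is the vertex set, viewed as a complete set of orthogonal idempotents in $B$. $(-)^*$ is the vector space dual; for a finite-dimensional space $W$, $\mathbb P(W^* )$ is identified with the set of codimension-1 subspaces of $W$. Each $\phi\in H_B$ induces an invertible linear map on $u(J(B)/J(B)^2)v$, and hence acts on its codimension-1 subspaces. *)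

(* Defs.v *)
From Stdlib Require Import Classical ClassicalEpsilon.
From HB Require Import structures.
From mathcomp Require Import all_boot all_order all_algebra all_field finmap.
From mathcomp Require Import monalg.

Set Implicit Arguments.
Unset Strict Implicit.
Unset Printing Implicit Defensive.

Import GRing.Theory.
Local Open Scope ring_scope.

Record quiver := Quiver {
  vertex : finType;
  arrow : finType;
  src : arrow -> vertex;
  tgt : arrow -> vertex
}.

Section Paths.
Variable Q : quiver.

(* [walk u s]: the arrows of [s] can be travelled one after the other,
   from left to right, starting at the vertex [u]. *)
Fixpoint walk (u : vertex Q) (s : seq (arrow Q)) : bool :=
  if s is a :: s' then (src a == u) && walk (tgt a) s' else true.

Definition walk_end (u : vertex Q) (s : seq (arrow Q)) : vertex Q :=
  last u (map (@tgt Q) s).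

Definition qpath := {p : vertex Q * seq (arrow Q) | walk p.1 p.2}.

Definition qstart (p : qpath) : vertex Q := (val p).1.
Definition qend (p : qpath) : vertex Q := walk_end (val p).1 (val p).2.

Definition qtriv (u : vertex Q) : qpath :=
  exist (fun p : vertex Q * seq (arrow Q) => walk p.1 p.2) (u, [::]) isT.

Lemma qarr_subproof (a : arrow Q) : walk (src a) [:: a].
Proof. by rewrite /= eqxx. Qed.

Definition qarr (a : arrow Q) : qpath :=
  exist (fun p : vertex Q * seq (arrow Q) => walk p.1 p.2)
    (src a, [:: a]) (qarr_subproof a).

(* [p] followed by [q], when [q] starts where [p] ends; thus the path algebra
   is written so that a path from [u] to [v] lies in [u * kQ * v]. *)
Definition qcat (p q : qpath) : option qpath :=
  if qend p == qstart q
  then (insub (qstart p, (val p).2 ++ (val q).2) : option qpath) else None.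

Lemma walk_cat u s t : walk u (s ++ t) = walk u s && walk (walk_end u s) t.
Proof. by elim: s u => [|a s IH] u //=; rewrite IH andbA. Qed.

Lemma walk_end_cat u s t :
  walk_end u (s ++ t) = walk_end (walk_end u s) t.
Proof. by rewrite /walk_end map_cat last_cat. Qed.

Variant qcat_spec (p q : qpath) : option qpath -> bool -> Type :=
| QcatSome r of qend p = qstart q & qstart r = qstart p & qend r = qend q
    & (val r).2 = (val p).2 ++ (val q).2 : qcat_spec p q (Some r) true
| QcatNone of qend p != qstart q : qcat_spec p q None false.

Lemma qcatP p q : qcat_spec p q (qcat p q) (qend p == qstart q).
Proof.
rewrite /qcat; case: eqP => [e|/eqP ne]; last by constructor.
have w : walk (qstart p) ((val p).2 ++ (val q).2).
  rewrite walk_cat; apply/andP; split; first exact: (valP p).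
  by have := valP q; rewrite -/(qstart q) -e.
case: insubP => [r _ er|]; last by rewrite w.
constructor => //; rewrite /qstart /qend ?er //=.
rewrite walk_end_cat; move: e; rewrite /qend /qstart => e.
by rewrite e.
Qed.

Lemma qpath_inj (p q : qpath) :
  qstart p = qstart q -> (val p).2 = (val q).2 -> p = q.
Proof.
rewrite /qstart => e1 e2; apply: val_inj.
by rewrite [LHS]surjective_pairing [RHS]surjective_pairing e1 e2.
Qed.

Lemma qcatA p q r :
  obind (qcat p) (qcat q r) = obind (qcat^~ r) (qcat p q).
Proof.
case: (qcatP q r) => [s eqr s1 s2 s3|nqr] /=.
  case: (qcatP p q) => [t epq t1 t2 t3|npq] /=.
    case: (qcatP p s) => [x _ x1 _ x3|]; last by rewrite s1 epq eqxx.
    case: (qcatP t r) => [y _ y1 _ y3|]; last by rewrite t2 eqr eqxx.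
    by congr Some; apply: qpath_inj; rewrite ?x1 ?y1 // x3 y3 s3 t3 catA.
  case: (qcatP p s) => // x e; by rewrite e s1 eqxx in npq.
case: (qcatP p q) => [t epq t1 t2 t3|npq] //=.
case: (qcatP t r) => // y e; by rewrite -t2 e eqxx in nqr.
Qed.

Lemma qcat_trivl u p : qcat (qtriv u) p = if u == qstart p then Some p else None.
Proof.
case: (qcatP (qtriv u) p) => [r|]; rewrite /qend /walk_end /=.
  move=> -> r1 _ r3; rewrite ?eqxx; congr Some; apply: qpath_inj => //.
by [].
Qed.

Lemma qcat_trivr u p : qcat p (qtriv u) = if u == qend p then Some p else None.
Proof.
case: (qcatP p (qtriv u)) => [r|]; rewrite {1}/qstart /=.
  move=> -> r1 _ r3; rewrite ?eqxx; congr Some; apply: qpath_inj => //.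
  by rewrite r3 cats0.
by rewrite eq_sym => /negbTE ne; rewrite ?ne.
Qed.

End Paths.

Definition pathalg (k : fieldType) (Q : quiver) := {malg k[qpath Q]}.
HB.instance Definition _ (k : fieldType) (Q : quiver) :=
  Choice.on (pathalg k Q).

(* The vector space structure of [pathalg] is that of [{malg k[_]}]. It is
   locked, since unification otherwise unfolds the operations endlessly. *)
HB.lock Definition padd (k : fieldType) (Q : quiver) (f g : pathalg k Q) :
  pathalg k Q := fgadd f g.
Canonical padd_unlockable := Unlockable padd.unlock.

HB.lock Definition popp (k : fieldType) (Q : quiver) (f : pathalg k Q) :
  pathalg k Q := fgopp f.
Canonical popp_unlockable := Unlockable popp.unlock.

HB.lock Definition pzero (k : fieldType) (Q : quiver) : pathalg k Q :=
  fgzero _ _.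
Canonical pzero_unlockable := Unlockable pzero.unlock.

HB.lock Definition pscale (k : fieldType) (Q : quiver) (c : k)
  (f : pathalg k Q) : pathalg k Q := fgscale c f.
Canonical pscale_unlockable := Unlockable pscale.unlock.

Section PathModule.
Variables (k : fieldType) (Q : quiver).
Local Notation pathalg := (pathalg k Q).
Local Notation padd := (@padd k Q).
Local Notation popp := (@popp k Q).
Local Notation pzero := (@pzero k Q).
Local Notation pscale := (@pscale k Q).
Implicit Types f g : pathalg.

Lemma pathalgP f g : (forall p, f@_p = g@_p) -> f = g.
Proof. by move=> e; apply/malgP. Qed.

Let pcoefD0 f g p : (padd f g)@_p = f@_p + g@_p.
Proof. by rewrite unlock fgaddE. Qed.

Let pcoefN0 f p : (popp f)@_p = - f@_p.
Proof. by rewrite unlock fgoppE. Qed.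

Let pcoef00 p : pzero@_p = 0.
Proof. by rewrite unlock fgzeroE. Qed.

Let pcoefZ0 c f p : (pscale c f)@_p = c * f@_p.
Proof. by rewrite unlock fgscaleE. Qed.

Lemma paddA : associative padd.
Proof. by move=> f g h; apply: pathalgP => p; rewrite !pcoefD0 addrA. Qed.

Lemma paddC : commutative padd.
Proof. by move=> f g; apply: pathalgP => p; rewrite !pcoefD0 addrC. Qed.

Lemma padd0 : left_id pzero padd.
Proof. by move=> f; apply: pathalgP => p; rewrite pcoefD0 pcoef00 add0r. Qed.

Lemma paddN : left_inverse pzero popp padd.
Proof.
by move=> f; apply: pathalgP => p; rewrite pcoefD0 pcoefN0 pcoef00 addNr.
Qed.

HB.instance Definition _ :=
  GRing.isZmodule.Build pathalg paddA paddC padd0 paddN.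

Lemma pcoefD f g p : (f + g)@_p = f@_p + g@_p. Proof. exact: pcoefD0. Qed.
Lemma pcoef0 p : (0 : pathalg)@_p = 0. Proof. exact: pcoef00. Qed.

Lemma pscaleA c d f : pscale c (pscale d f) = pscale (c * d) f.
Proof. by apply: pathalgP => p; rewrite !pcoefZ0 mulrA. Qed.

Lemma pscale1 : left_id 1 pscale.
Proof. by move=> f; apply: pathalgP => p; rewrite pcoefZ0 mul1r. Qed.

Lemma pscaleDr : right_distributive pscale +%R.
Proof.
by move=> c f g; apply: pathalgP => p; rewrite pcoefZ0 !pcoefD !pcoefZ0 mulrDr.
Qed.

Lemma pscaleDl f : {morph pscale^~ f : c d / c + d}.
Proof.
by move=> c d; apply: pathalgP => p; rewrite pcoefD !pcoefZ0 mulrDl.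
Qed.

HB.instance Definition _ := GRing.Zmodule_isLmodule.Build k pathalg
  pscaleA pscale1 pscaleDr pscaleDl.

Lemma pcoefZ c f p : (c *: f)@_p = c * f@_p. Proof. exact: pcoefZ0. Qed.

End PathModule.

HB.lock Definition pelt (k : fieldType) (Q : quiver) (p : qpath Q) :
  pathalg k Q := << p >>.
Canonical pelt_unlockable := Unlockable pelt.unlock.

Definition opelt (k : fieldType) (Q : quiver) (o : option (qpath Q)) :
  pathalg k Q := if o is Some p then pelt k p else 0.

HB.lock Definition pmul (k : fieldType) (Q : quiver) (f g : pathalg k Q) :
    pathalg k Q :=
  \sum_(p <- msupp f) \sum_(q <- msupp g)
    (f@_p * g@_q) *: opelt k (qcat p q).
Canonical pmul_unlockable := Unlockable pmul.unlock.

Section PathAlgebraTheory.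
Variables (k : fieldType) (Q : quiver).
Local Notation pathalg := (pathalg k Q).
Local Notation pmul := (@pmul k Q).
Local Notation pelt := (@pelt k Q).
Local Notation opelt := (@opelt k Q).
Implicit Types f g h : pathalg.

Lemma pmulE f g : pmul f g =
  \sum_(p <- msupp f) \sum_(q <- msupp g) (f@_p * g@_q) *: opelt (qcat p q).
Proof. by rewrite unlock. Qed.

Definition pone : pathalg := \sum_(u : vertex Q) pelt (qtriv u).

Lemma psuppD f g : (msupp (f + g)%R `<=` msupp f `|` msupp g)%fset.
Proof.
apply/fsubsetP => p; rewrite in_fsetU -!mcoeff_neq0 pcoefD -negb_and.
by apply: contra => /andP[/eqP -> /eqP ->]; rewrite addr0.
Qed.

Lemma psuppZ c f : (msupp (c *: f)%R `<=` msupp f)%fset.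
Proof.
apply/fsubsetP => p; rewrite -!mcoeff_neq0 pcoefZ.
by apply: contra => /eqP ->; rewrite mulr0.
Qed.

Lemma psupp0 : msupp (0 : pathalg) = fset0.
Proof. by apply/fsetP => p; rewrite -mcoeff_neq0 pcoef0 eqxx. Qed.

Lemma pmulw (d1 d2 : {fset qpath Q}) f g :
  (msupp f `<=` d1)%fset -> (msupp g `<=` d2)%fset ->
  pmul f g = \sum_(p <- d1) \sum_(q <- d2) (f@_p * g@_q) *: opelt (qcat p q).
Proof.
move=> s1 s2; rewrite pmulE; rewrite (big_fset_incl _ s1); last first.
  move=> p _ /mcoeff_outdom ->; rewrite big1 // => q _.
  by rewrite mul0r scale0r.
apply: eq_bigr => p _; apply: (big_fset_incl _ s2) => q _ /mcoeff_outdom ->.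
by rewrite mulr0 scale0r.
Qed.

Lemma pmulDl : left_distributive pmul +%R.
Proof.
move=> f g h; pose d := (msupp f `|` msupp g)%fset.
rewrite (@pmulw d (msupp h) (f + g)) ?psuppD //.
rewrite (@pmulw d (msupp h) f) ?fsubsetUl // (@pmulw d (msupp h) g) ?fsubsetUr //.
rewrite -big_split; apply: eq_bigr => p _; rewrite -big_split.
by apply: eq_bigr => q _; rewrite pcoefD mulrDl scalerDl.
Qed.

Lemma pmulDr : right_distributive pmul +%R.
Proof.
move=> h f g; pose d := (msupp f `|` msupp g)%fset.
rewrite (@pmulw (msupp h) d h (f + g)) ?psuppD //.
rewrite (@pmulw (msupp h) d h f) ?fsubsetUl //.
rewrite (@pmulw (msupp h) d h g) ?fsubsetUr //.
rewrite -big_split; apply: eq_bigr => p _; rewrite -big_split.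
by apply: eq_bigr => q _; rewrite pcoefD mulrDr scalerDl.
Qed.

Lemma pmul0l f : pmul 0 f = 0.
Proof. by rewrite pmulE psupp0 big_seq_fset0. Qed.

Lemma pmul0r f : pmul f 0 = 0.
Proof. by rewrite pmulE psupp0 big1 // => p _; rewrite big_seq_fset0. Qed.

Lemma pmulZl c f g : pmul (c *: f) g = c *: pmul f g.
Proof.
rewrite (@pmulw (msupp f) (msupp g)) ?psuppZ // pmulE scaler_sumr.
apply: eq_bigr => p _; rewrite scaler_sumr; apply: eq_bigr => q _.
by rewrite pcoefZ scalerA mulrA.
Qed.

Lemma pmulZr c f g : pmul f (c *: g) = c *: pmul f g.
Proof.
rewrite (@pmulw (msupp f) (msupp g)) ?psuppZ // pmulE scaler_sumr.
apply: eq_bigr => p _; rewrite scaler_sumr; apply: eq_bigr => q _.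
by rewrite pcoefZ scalerA mulrCA.
Qed.

Lemma peltE p : pelt p = << p >>.
Proof. by rewrite unlock. Qed.

Lemma pmul_pelt p q : pmul (pelt p) (pelt q) = opelt (qcat p q).
Proof.
rewrite (@pmulw [fset p]%fset [fset q]%fset) ?peltE ?msuppU_le //.
by rewrite !big_seq_fset1 !mcoeffUU mulr1 scale1r.
Qed.

Lemma peltZ (c : k) p : << c *g p >> = c *: pelt p.
Proof.
rewrite peltE; apply/malgP => q; rewrite [RHS](pcoefZ c << p >> q).
rewrite [LHS]mcoeffU [X in _ * X](mcoeffU p 1 q).
by case: (p == q); rewrite /= ?mulr1 ?mulr0.
Qed.

Lemma pathalg_ind (P : pathalg -> Prop) :
  P 0 -> (forall f g, P f -> P g -> P (f + g)) ->
  (forall c f, P f -> P (c *: f)) -> (forall p, P (pelt p)) -> forall f, P f.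
Proof.
move=> P0 PD PZ Pp f; rewrite (monalgE f); apply: big_ind => [|g h Pg Ph|p _].
- suff <- : (0 : pathalg) = (0 : {malg k[qpath Q]}) by [].
  by apply: pathalgP => q; rewrite pcoef0 mcoeff0.
- suff <- : (g : pathalg) + (h : pathalg) = (g + h : {malg k[qpath Q]}).
    exact: PD.
  by apply: pathalgP => q; rewrite pcoefD mcoeffD.
- by rewrite peltZ; apply: PZ.
Qed.

Lemma pmulA : associative pmul.
Proof.
move=> f g h; elim/pathalg_ind: f => [|f f' E E'|c f E|p].
- by rewrite !pmul0l.
- by rewrite !pmulDl E E'.
- by rewrite !pmulZl E.
elim/pathalg_ind: g => [|g g' E E'|c g E|q].
- by rewrite pmul0l !pmul0r pmul0l.
- by rewrite pmulDl !pmulDr pmulDl E E'.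
- by rewrite pmulZl !pmulZr pmulZl E.
elim/pathalg_ind: h => [|h h' E E'|c h E|r].
- by rewrite !pmul0r.
- by rewrite !pmulDr E E'.
- by rewrite !pmulZr E.
rewrite !pmul_pelt; have := qcatA p q r.
case: (qcat q r) => [s|]; case: (qcat p q) => [t|] /=.
- by rewrite !pmul_pelt => ->.
- by rewrite pmul_pelt pmul0l => ->.
- by rewrite pmul_pelt pmul0r => <-.
- by rewrite pmul0l pmul0r.
Qed.

Lemma pmul_suml (T : finType) (F : T -> pathalg) g :
  pmul (\sum_i F i) g = \sum_i pmul (F i) g.
Proof.
by apply: (big_morph (pmul^~ g)) => [f f'|]; rewrite ?pmulDl ?pmul0l.
Qed.

Lemma pmul_sumr (T : finType) (F : T -> pathalg) g :
  pmul g (\sum_i F i) = \sum_i pmul g (F i).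
Proof. by apply: (big_morph (pmul g)) => [f f'|]; rewrite ?pmulDr ?pmul0r. Qed.

Lemma pmul1l : left_id pone pmul.
Proof.
move=> f; elim/pathalg_ind: f => [|f f' E E'|c f E|p].
- by rewrite pmul0r.
- by rewrite pmulDr E E'.
- by rewrite pmulZr E.
rewrite pmul_suml (bigD1 (qstart p)) //= pmul_pelt qcat_trivl eqxx /=.
rewrite big1 ?addr0 // => u /negbTE ne.
by rewrite pmul_pelt qcat_trivl ne.
Qed.

Lemma pmul1r : right_id pone pmul.
Proof.
move=> f; elim/pathalg_ind: f => [|f f' E E'|c f E|p].
- by rewrite pmul0l.
- by rewrite pmulDl E E'.
- by rewrite pmulZl E.
rewrite pmul_sumr (bigD1 (qend p)) //= pmul_pelt qcat_trivr eqxx /=.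
rewrite big1 ?addr0 // => u /negbTE ne.
by rewrite pmul_pelt qcat_trivr ne.
Qed.

HB.instance Definition _ := GRing.Zmodule_isPzRing.Build pathalg
  pmulA pmul1l pmul1r pmulDl pmulDr.

Lemma pathalg_scalerAl (c : k) f g : c *: (f * g) = (c *: f) * g.
Proof. by rewrite [RHS]pmulZl. Qed.

Lemma pathalg_scalerAr (c : k) f g : c *: (f * g) = f * (c *: g).
Proof. by rewrite [RHS]pmulZr. Qed.

Definition vertex_elt (u : vertex Q) : pathalg := pelt (qtriv u).
Definition arrow_elt (a : arrow Q) : pathalg := pelt (qarr a).

End PathAlgebraTheory.

Section Ideals.
Variable R : pzRingType.
Implicit Types I J S : R -> Prop.

Definition two_sided_ideal I : Prop :=
  [/\ I 0, forall x y, I x -> I y -> I (x + y),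
      forall a x, I x -> I (a * x) & forall a x, I x -> I (x * a)].

Definition ideal_gen S : R -> Prop :=
  fun x => forall I, two_sided_ideal I -> (forall s, S s -> I s) -> I x.

Definition ideal_mul I J : R -> Prop :=
  ideal_gen (fun z => exists x y, [/\ I x, J y & z = x * y]).

Fixpoint ideal_exp I (n : nat) : R -> Prop :=
  if n is m.+1 then ideal_mul I (ideal_exp I m) else fun _ => True.

End Ideals.

Section Admissible.
Variables (k : fieldType) (Q : quiver).

Definition arrow_ideal : pathalg k Q -> Prop :=
  ideal_gen (fun x => exists a : arrow Q, x = arrow_elt k a).

Definition admissible (I : pathalg k Q -> Prop) : Prop :=
  [/\ two_sided_ideal I,
      forall x, I x -> ideal_exp arrow_ideal 2 x &
      exists2 l : nat, (2 <= l)%N & forall x, ideal_exp arrow_ideal l x -> I x].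

(* [B], with the projection [pi], is the quotient algebra [kQ / I]. (The path
   algebra is not declared as an [algType], which would exclude the quiver
   without vertices; hence no [{lrmorphism _ -> _}] here.) *)
Definition is_quotient_by (I : pathalg k Q -> Prop) (B : falgType k)
    (pi : {linear pathalg k Q -> B}) : Prop :=
  [/\ monoid_morphism pi, forall b, exists x, pi x = b &
      forall x, pi x = 0 <-> I x].

End Admissible.

Section Jacobson.
Variables (k : fieldType) (B : falgType k).

(* Left ideals of a unital [k]-algebra are [k]-subspaces. *)
Definition left_ideal (L : {vspace B}) : Prop := (fullv * L <= L)%VS.

Definition maximal_left_ideal (L : {vspace B}) : Prop :=
  [/\ left_ideal L, L <> fullv &
      forall L' : {vspace B},
        left_ideal L' -> (L <= L')%VS -> L' = L \/ L' = fullv].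

Lemma bigcap_vspace_subproof (P : {vspace B} -> Prop) :
  exists J : {vspace B}, forall x, x \in J <-> (forall L, P L -> x \in L).
Proof.
pose good n := exists J : {vspace B},
  \dim J = n /\ forall x, (forall L, P L -> x \in L) -> x \in J.
have good_full : good (\dim {:B}) by exists fullv; split=> // x _; exact: memvf.
have [n [[J [dJ sJ]] minJ]] : exists n, good n /\ forall m, good m -> (n <= m)%N.
  elim/ltn_ind: (\dim {:B}) good_full => n IH gn.
  case: (classic (exists2 m, (m < n)%N & good m)) => [[m /IH]|no]; first exact.
  exists n; split=> // m gm; rewrite leqNgt; apply/negP => lt_mn.
  by apply: no; exists m.
exists J => x; split; last exact: sJ.
move=> xJ L PL.
have /minJ le_n : good (\dim (J :&: L)).
  exists (J :&: L)%VS; split=> // y Py; rewrite memv_cap sJ // Py //.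
have /eqP e : (J :&: L)%VS == J by rewrite eqEdim capvSl dJ.
by move: xJ; rewrite -e memv_cap => /andP[].
Qed.

(* The intersection of all maximal left ideals; the choice operator is only
   used to bundle it as a [{vspace B}], see [jacobsonP]. *)
Definition jacobson : {vspace B} :=
  proj1_sig (constructive_indefinite_description _
    (bigcap_vspace_subproof maximal_left_ideal)).

Lemma jacobsonP x :
  x \in jacobson <-> (forall L, maximal_left_ideal L -> x \in L).
Proof. by rewrite /jacobson; case: constructive_indefinite_description. Qed.

End Jacobson.

Section QuotientSpace.
Variables (k : fieldType) (V : vectType k) (W : {vspace V}).

(* The quotient vector space [V / W], carried by the complement [W^C] of [W]
   chosen by the library; [quotv_pi] is the canonical projection. *)
Definition quotv : vectType k := subvs_of (W^C)%VS.

Definition quotv_pi : 'Hom(V, quotv) :=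
  (linfun (vsproj (W^C)%VS) \o daddv_pi (W^C)%VS W)%VF.

Definition quotv_repr : 'Hom(quotv, V) := linfun vsval.

(* The endomorphism of [V / W] induced by an [f] such that [f W <= W]. *)
Definition quotv_map (f : 'End(V)) : 'End(quotv) :=
  (quotv_pi \o f \o quotv_repr)%VF.

Lemma quotv_capC : (W^C :&: W = 0)%VS.
Proof. by rewrite capvC capv_compl. Qed.

Lemma val_quotv_pi x : vsval (quotv_pi x) = daddv_pi (W^C)%VS W x.
Proof. by rewrite comp_lfunE lfunE /= vsprojK // memv_pi. Qed.

Lemma quotv_reprK : cancel quotv_repr quotv_pi.
Proof.
move=> y; apply: val_inj; rewrite /= val_quotv_pi lfunE /=.
by rewrite daddv_pi_id ?quotv_capC // subvsP.
Qed.

Lemma quotv_piK x : quotv_repr (quotv_pi x) - x \in W.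
Proof.
rewrite lfunE /= val_quotv_pi -opprB memvN.
have xf : x \in (W^C + W)%VS by rewrite addvC addv_complf memvf.
rewrite -{1}(daddv_pi_add quotv_capC xf) addrC addKr.
exact: memv_pi.
Qed.

Lemma quotv_pi_eq0 x : (quotv_pi x == 0) = (x \in W).
Proof.
apply/eqP/idP => [e|xW].
  by have := quotv_piK x; rewrite e linear0 sub0r memvN.
have xf : x \in (W^C + W)%VS by rewrite addvC addv_complf memvf.
have := daddv_pi_add quotv_capC xf.
rewrite (daddv_pi_id (capv_compl W) xW) => e.
have e0 : daddv_pi (W^C)%VS W x = 0 by apply: (addIr x); rewrite e add0r.
by apply: val_inj; rewrite /= val_quotv_pi e0.
Qed.

Lemma quotv_mapE (f : 'End(V)) x :
  (f @: W <= W)%VS -> quotv_map f (quotv_pi x) = quotv_pi (f x).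
Proof.
move=> fW; rewrite [LHS]comp_lfunE [LHS]comp_lfunE.
set y := quotv_repr _.
have : f y - f x \in W.
  rewrite -linearB; apply: (subvP fW); apply: memv_img.
  exact: quotv_piK.
by rewrite -quotv_pi_eq0 linearB subr_eq0 => /eqP.
Qed.

End QuotientSpace.

(* [X] is the union of the orbits of the elements of a finite list;
   [orb y x] means that [x] is in the orbit of [y]. *)
Definition finite_union_of_orbits (T : eqType) (orb : T -> T -> Prop)
    (X : T -> Prop) : Prop :=
  exists s : seq T, forall x, X x <-> exists2 y, y \in s & orb y x.

Section Main.
Variables (k : fieldType) (B : falgType k).

Definition AlgGr (m : nat) (A : {vspace B}) : Prop :=
  [/\ 1 \in A, (A * A <= A)%VS & \dim A = m].

Definition is_aut (f : 'AEnd(B)) : Prop := bijective f.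

Definition aut_orbit (A A' : {vspace B}) : Prop :=
  exists2 f : 'AEnd(B), is_aut f & A' = (f @: A)%VS.

Local Notation J := (jacobson B).

Lemma aut_preim_maximal (f : 'AEnd(B)) (L : {vspace B}) :
  is_aut f -> maximal_left_ideal L -> maximal_left_ideal (f @^-1: L)%VS.
Proof.
case=> g fK gK [Ll Lnf Lmax]; split.
- apply/prodvP => a y _; rewrite -!memv_preim rmorphM => yL.
  by apply: (subvP Ll); rewrite memv_mul ?memvf.
- move=> e; apply: Lnf; apply/vspaceP => x; rewrite memvf -(gK x) memv_preim.
  by rewrite e memvf.
move=> L' L'l sub.
have imE x : (x \in (f @: L')%VS) = (g x \in L').
  apply/memv_imgP/idP => [[y yL ->]|gx]; first by rewrite fK.
  by exists (g x); rewrite ?gK.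
have il : left_ideal (f @: L')%VS.
  apply/prodvP => a x _; rewrite !imE => gx.
  have -> : g (a * x) = g a * g x.
    by apply: (can_inj fK); rewrite gK rmorphM /= !gK.
  by apply: (subvP L'l); rewrite memv_mul ?memvf.
have sL : (L <= f @: L')%VS.
  apply/subvP => x xL; rewrite imE; apply: (subvP sub).
  by rewrite -memv_preim gK.
case: (Lmax _ il sL) => e; [left|right]; apply/vspaceP => x.
  by rewrite -memv_preim -e imE fK.
by rewrite memvf -(fK x) -imE e memvf.
Qed.

(* Hence an automorphism of [B] induces a linear map on [B / J^2], namely
   [quotv_map (J * J) f], by [quotv_mapE]. *)
Lemma aut_jacobson2 (f : 'AEnd(B)) : is_aut f -> (f @: (J * J) <= J * J)%VS.
Proof.
move=> fa; have sJ : (f @: J <= J)%VS.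
  apply/subvP => _ /memv_imgP[y yJ ->]; apply/jacobsonP => L maxL.
  rewrite memv_preim; apply: (proj1 (jacobsonP y) yJ).
  exact: aut_preim_maximal.
by rewrite aimgM prodvS.
Qed.

(* [B / J^2], its subspace [u (J / J^2) v], and the codimension one subspaces
   of a space [U], i.e. the points of the projective space of [U^*]. *)
Definition BmodJ2 : vectType k := quotv (J * J)%VS.

Definition arrow_space (u v : B) : {vspace BmodJ2} :=
  (quotv_pi (J * J) @: (<[u]> * J * <[v]>))%VS.

Definition hyperplane_of (V : vectType k) (U W : {vspace V}) : Prop :=
  (W <= U)%VS /\ (\dim W).+1 = \dim U.

Variables (Q : quiver) (pi : {linear pathalg k Q -> B}).

Definition vertex_idem (u : vertex Q) : B := pi (vertex_elt k u).

Definition in_HB (f : 'AEnd(B)) : Prop :=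
  is_aut f /\ forall u : vertex Q, f (vertex_idem u) = vertex_idem u.

Definition HB_orbit (W W' : {vspace BmodJ2}) : Prop :=
  exists2 f : 'AEnd(B), in_HB f & W' = (quotv_map (J * J) f @: W)%VS.

End Main.

(* Main.v *)
Require Import Defs.
From Stdlib Require Import Classical ClassicalEpsilon.
From HB Require Import structures.
From mathcomp Require Import all_boot all_order all_algebra all_field finmap.
From mathcomp Require Import monalg.

Set Implicit Arguments.
Unset Strict Implicit.
Unset Printing Implicit Defensive.

Import GRing.Theory.
Local Open Scope ring_scope.

(* The coefficients at the trivial paths descend to characters chi_u of B, and
   the radical J is their common kernel. Let A be a subalgebra of codimension 1.
   If A contains J, then A = {chi_u = chi_v} for some u <> v. Otherwise
   M = A /\ J is a two-sided ideal of B, of codimension 1 in J and containing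
   J^2. Modulo M, the deviation of the vertices from A is an inner derivation,
   so that A contains the vertices after an inner automorphism; then A is the
   preimage of a hyperplane W of u(J/J^2)v under
   b |-> u (b - sum_w chi_w(b) w) v.
   Elements of H_B carry these preimages to each other as they act on the
   hyperplanes. Conversely, an automorphism f between two such subalgebras A, A'
   can be composed with conjugation by a unit of A' so as to permute the
   vertices; as there are finitely many permutations, each Aut(B)-orbit meets
   finitely many H_B-orbits of hyperplanes. *)

(** * Coefficients at the trivial paths of the path algebra *)

Section VertexCoefficient.
Variables (k : fieldType) (Q : quiver).
Local Notation kQ := (pathalg k Q).
Local Notation arrows := (@arrow_ideal k Q).

Definition vcoef (u : vertex Q) (f : kQ) : k := f@_(qtriv u).

Lemma vcoef_pelt u p : vcoef u (pelt k p) = (p == qtriv u)%:R.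
Proof. by rewrite /vcoef peltE mcoeffU; case: (p == qtriv u). Qed.

Lemma vcoefD u f g : vcoef u (f + g) = vcoef u f + vcoef u g.
Proof. exact: pcoefD. Qed.

Lemma vcoefZ u c f : vcoef u (c *: f) = c * vcoef u f.
Proof. exact: pcoefZ. Qed.

Lemma vcoef0 u : vcoef u 0 = 0.
Proof. exact: pcoef0. Qed.

Lemma vcoefB u f g : vcoef u (f - g) = vcoef u f - vcoef u g.
Proof. by rewrite -scaleN1r vcoefD vcoefZ mulN1r. Qed.

(** By bilinearity it suffices to treat paths, and a concatenation is the trivial path at [u]
    exactly when both factors are. *)
Lemma vcoefM u f g : vcoef u (f * g) = vcoef u f * vcoef u g.
Proof.
elim/pathalg_ind: f => [|f f' E E'|c f E|p].
- by rewrite mul0r vcoef0 mul0r.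
- by rewrite mulrDl !vcoefD E E' mulrDl.
- by rewrite -pathalg_scalerAl !vcoefZ E mulrA.
elim/pathalg_ind: g => [|g g' E E'|c g E|q].
- by rewrite mulr0 vcoef0 mulr0.
- by rewrite mulrDr !vcoefD E E' mulrDr.
- by rewrite -pathalg_scalerAr !vcoefZ E mulrCA.
rewrite [pelt k p * _]pmul_pelt !vcoef_pelt -natrM mulnb.
case: (qcatP p q) => [r epq r1 r2 r3|ne] /=.
  rewrite vcoef_pelt; congr (nat_of_bool _)%:R.
  apply/eqP/andP => [er|[/eqP ep /eqP eq]].
    move: r1 r3; rewrite er /qstart /= => r1 /esym/nilP.
    rewrite /nilp size_cat addn_eq0 => /andP[/nilP p0 /nilP q0].
    have ep : p = qtriv u by apply: qpath_inj; rewrite ?p0 // /qstart -r1.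
    split; apply/eqP => //; apply: qpath_inj => //; rewrite -epq ep //.
  by apply: qpath_inj; rewrite ?r1 ?r3 ep ?eq.
rewrite vcoef0; case: eqP => [ep|//]; case: eqP => [eq|//].
by move: ne; rewrite ep eq /qend /= eqxx.
Qed.

Lemma vcoef_vertex u w : vcoef u (vertex_elt k w) = (w == u)%:R.
Proof.
rewrite vcoef_pelt; congr (nat_of_bool _)%:R.
by apply/eqP/eqP => [[]|->].
Qed.

Lemma vcoef_ker_ideal u : two_sided_ideal (fun f : kQ => vcoef u f = 0).
Proof.
split=> [|x y|a x|a x]; rewrite ?vcoef0 ?vcoefD ?vcoefM //.
- by move=> -> ->; rewrite addr0.
- by move=> ->; rewrite mulr0.
- by move=> ->; rewrite mul0r.
Qed.

Lemma arrows_vcoef u f : arrows f -> vcoef u f = 0.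
Proof.
move/(_ _ (vcoef_ker_ideal u)); apply.
by move=> _ [a ->]; rewrite vcoef_pelt; case: eqP.
Qed.

Lemma arrows2_vcoef u f : ideal_exp arrows 2 f -> vcoef u f = 0.
Proof.
move/(_ _ (vcoef_ker_ideal u)); apply.
by move=> _ [x [y [/arrows_vcoef x0 _ ->]]]; rewrite vcoefM x0 mul0r.
Qed.

Lemma arrows_ideal : two_sided_ideal arrows.
Proof.
split.
- by move=> I [].
- move=> x y Ix Iy I iI sI; case: (iI) => _ ID _ _.
  by apply: ID; [apply: Ix | apply: Iy].
- by move=> a x Ix I iI sI; case: (iI) => _ _ IM _; apply: IM; apply: Ix.
- by move=> a x Ix I iI sI; case: (iI) => _ _ _ IM; apply: IM; apply: Ix.
Qed.

(** On a trivial path the difference is zero; a path of positive length is its first arrow times the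
    remaining path, and its coefficients at trivial paths vanish. *)
Lemma arrows_residue f :
  arrows (f - \sum_u vcoef u f *: vertex_elt k u).
Proof.
have [a0 aD aM _] := arrows_ideal.
elim/pathalg_ind: f => [|f g E E'|c f E|p].
- by rewrite big1 ?subr0 // => u _; rewrite vcoef0 scale0r.
- have := aD _ _ E E'; rewrite addrACA -opprD -big_split /=.
  congr (arrows (_ - _)).
  by apply: eq_bigr => u _; rewrite vcoefD scalerDl.
(* A two-sided ideal is only given as closed under ring multiplication, so scaling by [c] is
   multiplication by [c *: 1]. *)
- have := aM (c *: (1 : kQ) : kQ) _ E; rewrite -pathalg_scalerAl mul1r scalerBr.
  rewrite scaler_sumr.
  congr (arrows (_ - _)).
  by apply: eq_bigr => u _; rewrite vcoefZ scalerA.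
case ep: (val p).2 => [|a s].
  have -> : p = qtriv (qstart p) by apply: qpath_inj.
  rewrite (bigD1 (qstart p)) //= vcoef_vertex eqxx scale1r big1 ?addr0 ?subrr //.
  by move=> u ne; rewrite vcoef_vertex eq_sym (negbTE ne) scale0r.
rewrite big1 ?subr0; last first.
  move=> u _; rewrite vcoef_pelt; case: eqP => [pu|_]; rewrite ?scale0r //.
  by rewrite pu in ep.
move: (valP p); rewrite /= ep /= => /andP[/eqP sa ws].
pose q : qpath Q :=
  exist (fun p : vertex Q * seq (arrow Q) => walk p.1 p.2) (tgt a, s) ws.
have -> : pelt k p = arrow_elt k a * pelt k q.
  rewrite [RHS]pmul_pelt; case: (qcatP (qarr a) q) => [r _ r1 _ r3|] /=; last first.
    by rewrite /qend /walk_end /qstart /= eqxx.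
  by congr pelt; apply: qpath_inj; rewrite ?r1 ?r3 ?ep //.
case: arrows_ideal => _ _ _; apply.
by move=> I _ sI; apply: sI; exists a.
Qed.

Lemma arrows_exp f n : arrows f -> ideal_exp arrows n (f ^+ n).
Proof.
move=> Af; elim: n => [|n IH] //= J _ sJ.
by rewrite exprS; apply: sJ; exists f, (f ^+ n).
Qed.

End VertexCoefficient.

(** * Linear maps, nilpotent elements, subalgebras of codimension 1 *)

Definition lfun_of (k : fieldType) (U V : vectType k) (f : U -> V)
    (lin_f : linear f) : 'Hom(U, V) :=
  linfun (HB.pack_for {linear U -> V} f
    (GRing.isLinear.Build k U V *:%R f lin_f)).

Lemma lfun_ofE (k : fieldType) (U V : vectType k) (f : U -> V)
  (lin_f : linear f) : lfun_of lin_f =1 f.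
Proof. exact: lfunE. Qed.

(** The geometric series; being a polynomial in [x], this inverse stays in every subalgebra
    containing [x]. *)
Lemma nilp_inv (R : pzRingType) (x : R) n : x ^+ n = 0 ->
  (1 - x) * (\sum_(i < n) x ^+ i) = 1 /\ (\sum_(i < n) x ^+ i) * (1 - x) = 1.
Proof.
move=> xn; have e : (1 - x) * (\sum_(i < n) x ^+ i) = 1.
  by rewrite -opprB mulNr -subrX1 xn sub0r opprK.
split=> //; rewrite -[RHS]e; apply/commr_sym/commr_sum => i _.
by apply/commrX/commr_sym/commrB; [apply: commr1 | apply: commr_refl].
Qed.

Section Subalgebra.
Variables (k : fieldType) (B : falgType k).
Implicit Types (A : {vspace B}) (x y : B).

Lemma subalgM A x y : (A * A <= A)%VS -> x \in A -> y \in A -> x * y \in A.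
Proof. by move=> AA xA yA; apply: (subvP AA); apply: memv_mul. Qed.

Lemma subalgP A : (forall x y, x \in A -> y \in A -> x * y \in A) ->
  (A * A <= A)%VS.
Proof. by move=> AM; apply/prodvP. Qed.

Lemma subalgX A x n : 1 \in A -> (A * A <= A)%VS -> x \in A -> x ^+ n \in A.
Proof.
move=> A1 AA xA; elim: n => [|n IH]; first by rewrite expr0.
by rewrite exprS; apply: subalgM.
Qed.

Lemma codim1_decomp A x : \dim A = (\dim {:B} - 1)%N -> x \notin A ->
  forall b, exists c : k, b - c *: x \in A.
Proof.
move=> dA xA b.
have capA : (A :&: <[x]> = 0)%VS.
  apply/eqP; rewrite -subv0; apply/subvP => y; rewrite memv_cap memv0.
  case/andP=> yA /vlineP[c ey]; rewrite ey; move: yA; rewrite ey.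
  by rewrite rpredZeq (negbTE xA) orbF => /eqP->; rewrite scale0r.
have x0 : x != 0 by apply: contraNneq xA => ->; apply: mem0v.
have d1 : (0 < \dim {:B})%N.
  by rewrite lt0n dimv_eq0; apply: contraNneq x0 => e; rewrite -memv0 -e memvf.
have full : (A + <[x]> = fullv)%VS.
  apply/eqP; rewrite eqEdim subvf /= dimv_disjoint_sum // dim_vline x0 dA.
  by rewrite subnK.
have := memvf b; rewrite -full => /memv_addP[a aA [_ /vlineP[c ->] ->]].
by exists c; rewrite addrK.
Qed.

End Subalgebra.

(** * The radical as the common kernel of the characters *)

Section JacobsonRadical.
Variables (k : fieldType) (B : falgType k) (V : Type) (chi : V -> 'Hom(B, k^o)).
Hypothesis chiM : forall u x y, chi u (x * y) = chi u x * chi u y.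
Hypothesis chi1 : forall u, chi u 1 = 1.
Hypothesis chi_nil :
  forall x, (forall u, chi u x = 0) -> exists n, x ^+ n = 0.

Lemma left_ideal1 (L : {vspace B}) : left_ideal L -> 1 \in L -> L = fullv.
Proof.
move=> Ll L1; apply/vspaceP => x; rewrite memvf -[x]mulr1.
by apply: (subvP Ll); rewrite memv_mul ?memvf.
Qed.

Lemma ker_char_maximal u : maximal_left_ideal (lker (chi u)).
Proof.
split.
- apply/prodvP => a y _; rewrite !memv_ker chiM => /eqP->.
  by rewrite mulr0.
- move=> /vspaceP/(_ 1); rewrite memvf memv_ker chi1.
  by rewrite (oner_eq0 k).
move=> L Ll sL; case: (boolP (L <= lker (chi u))%VS) => [sL'|/subvPn[y yL]].
  by left; apply/eqP; rewrite eqEsubv sL' sL.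
rewrite memv_ker => y0; right; apply: left_ideal1 => //.
rewrite -[1](subrK ((chi u y)^-1 *: y)) memvD ?memvZ //.
apply: (subvP sL); rewrite memv_ker linearB linearZ /= chi1.
by rewrite -[_ *: _]/(_ * _) mulVf ?subrr.
Qed.

(** Kernels of characters are maximal left ideals. Conversely, if all characters kill [x] and a
    maximal left ideal [L] misses [x], then [1 = l + a * x] with [l] in [L]; as [a * x] is
    nilpotent, [l] is a unit, which is absurd. *)
Lemma jacobson_chars x : x \in jacobson B <-> (forall u, chi u x = 0).
Proof.
split=> [/jacobsonP xJ u|x0].
  by apply/eqP; rewrite -memv_ker; apply: xJ; apply: ker_char_maximal.
apply/jacobsonP => L [Ll Lf Lmax].
have l' : left_ideal (L + fullv * <[x]>)%VS.
  rewrite /left_ideal prodvDr prodvA; apply: addvS => //.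
  by apply: prodvSl; apply: subvf.
case: (Lmax _ l' (addvSl _ _)) => [<-|full].
  apply: (subvP (addvSr _ _)); rewrite -[X in X \in _]mul1r.
  by apply: memv_mul; rewrite ?memvf ?memv_line.
have := memvf (1 : B); rewrite -full => /memv_addP[l lL [y /memv_cosetP[a _ ->] e]].
case: (@chi_nil (a * x)) => [u|n axn]; first by rewrite chiM x0 mulr0.
case: Lf; apply: left_ideal1 => //; have [_ <-] := nilp_inv axn.
rewrite [X in X - _]e addrK; apply: (subvP Ll).
by apply: memv_mul; rewrite ?memvf.
Qed.

End JacobsonRadical.

(** * Idempotents and characters of kQ/I *)

Section QuotientCharacters.
Variables (k : fieldType) (Q : quiver) (I : pathalg k Q -> Prop).
Variables (B : falgType k) (pi : {linear pathalg k Q -> B}).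
Hypotheses (admI : admissible I) (quoI : is_quotient_by I pi).
Local Notation e := (vertex_idem pi).

Lemma quotient_idemM u v : e u * e v = (u == v)%:R *: e u.
Proof.
case: quoI => -[_ piM] _ _; rewrite /vertex_idem -piM -linearZ /=; congr (pi _).
rewrite [LHS]pmul_pelt qcat_trivl {1}/qstart /=.
by case: eqP => [->|_]; rewrite ?scale1r ?scale0r.
Qed.

Lemma quotient_idem1 : \sum_u e u = 1.
Proof. by case: quoI => -[pi1 _] _ _; rewrite -pi1 -linear_sum. Qed.

(** The coefficients at trivial paths vanish on the square of the arrow ideal, which contains [I],
    so they descend to [B]. An element killed by all of them lifts to the arrow ideal, some power of
    which lies in [I]. *)
Lemma quotient_characters : exists chi : vertex Q -> 'Hom(B, k^o),
  [/\ forall u w, chi u (e w) = (w == u)%:R,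
      forall u x y, chi u (x * y) = chi u x * chi u y &
      forall x, (forall u, chi u x = 0) -> exists n, x ^+ n = 0].
Proof.
case: quoI => -[pi1 piM] pi_surj pi0; case: admI => _ I2 [l _ lI].
have Iv u f : I f -> vcoef u f = 0 by move=> /I2/arrows2_vcoef.
(* An arbitrary section of [pi]; [cE] shows that the choice does not affect the coefficients. *)
pose r b := proj1_sig (constructive_indefinite_description _ (pi_surj b)).
have piK b : pi (r b) = b.
  by rewrite /r; case: constructive_indefinite_description.
pose c u b : k := vcoef u (r b).
have cE u f : c u (pi f) = vcoef u f.
  apply/eqP; rewrite -subr_eq0 -vcoefB; apply/eqP/Iv/pi0.
  by rewrite linearB piK subrr.
have c_lin u : linear (c u : B -> k^o).
  move=> a x y; rewrite -{1}[x]piK -{1}[y]piK -linearP cE.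
  by rewrite vcoefD vcoefZ.
exists (fun u => lfun_of (c_lin u)); split=> [u w|u x y|x x0].
- by rewrite lfun_ofE cE vcoef_vertex.
- by rewrite !lfun_ofE -{1}[x]piK -{1}[y]piK -piM cE vcoefM.
have Ax : arrow_ideal (r x).
  have := arrows_residue (r x); rewrite big1 ?subr0 // => u _.
  by have := x0 u; rewrite lfun_ofE /c => ->; rewrite scale0r.
exists l; rewrite -[x]piK.
have /lI/pi0 <- := arrows_exp l Ax.
by elim: l {lI} => [|l IH]; rewrite ?expr0 // !exprS piM IH.
Qed.

End QuotientCharacters.

(** * Automorphisms and their orbits on subspaces *)

Section Automorphisms.
Variables (k : fieldType) (B : falgType k).
Implicit Types (f g : 'AEnd(B)) (A : {vspace B}).

Lemma lfun_of_ahom (F : B -> B) (lin_F : linear F) :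
  F 1 = 1 -> {morph F : x y / x * y} -> ahom_in {:B} (lfun_of lin_F).
Proof.
move=> F1 FM; apply/ahom_inP; split; rewrite ?lfun_ofE //.
by move=> x y _ _; rewrite !lfun_ofE.
Qed.

Lemma aut_inv f : is_aut f ->
  exists f' : 'AEnd(B), [/\ is_aut f', cancel f f' & cancel f' f].
Proof.
case=> h fK hK.
have lin_h : linear h.
  by move=> a x y; apply: (can_inj fK); rewrite linearP /= !hK.
have h1 : h 1 = 1 by apply: (can_inj fK); rewrite hK rmorph1.
have hM : {morph h : x y / x * y}.
  by move=> x y; apply: (can_inj fK); rewrite rmorphM /= !hK.
pose f' := AHom (lfun_of_ahom lin_h h1 hM).
have f'E : f' =1 h by move=> x; rewrite [LHS]lfun_ofE.
exists f'; split.
- by exists f => x; rewrite f'E.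
- by move=> x; rewrite f'E.
- by move=> x; rewrite f'E.
Qed.

Lemma aut_comp f g : is_aut f -> is_aut g ->
  exists2 h : 'AEnd(B), is_aut h & forall x, h x = f (g x).
Proof.
move=> fa ga; exists (comp_ahom f g) => [|x]; last by rewrite [LHS]comp_lfunE.
by apply: (eq_bij (bij_comp fa ga)) => x; rewrite [RHS]comp_lfunE.
Qed.

Lemma inner_aut (g g' : B) : g * g' = 1 -> g' * g = 1 ->
  exists2 f : 'AEnd(B), is_aut f & forall x, f x = g * x * g'.
Proof.
move=> gg' g'g; pose F x := g * x * g'.
have lin_F : linear F.
  by move=> a x y; rewrite /F mulrDr mulrDl -scalerAr -scalerAl.
have F1 : F 1 = 1 by rewrite /F mulr1.
have FM : {morph F : x y / x * y}.
  by move=> x y; rewrite /F !mulrA -(mulrA (g * x) g' g) g'g mulr1.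
exists (AHom (lfun_of_ahom lin_F F1 FM)) => [|x]; last by rewrite [LHS]lfun_ofE.
exists (fun x => g' * x * g) => x.
  by rewrite /= lfun_ofE /F !mulrA g'g mul1r -mulrA g'g mulr1.
by rewrite /= lfun_ofE /F !mulrA gg' mul1r -mulrA gg' mulr1.
Qed.

Lemma dim_aut_img f A : is_aut f -> \dim (f @: A) = \dim A.
Proof.
move=> /bij_inj fi; apply: limg_dim_eq.
by move/lker0P/eqP: fi => ->; rewrite capv0.
Qed.

Lemma aut_limg f A f' : cancel f f' -> cancel f' f ->
  (f' @: (f @: A))%VS = A.
Proof.
move=> fK f'K; apply/vspaceP => x; apply/memv_imgP/idP.
  by case=> _ /memv_imgP[y yA ->] ->; rewrite fK.
by move=> xA; exists (f x); rewrite ?fK // memv_img.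
Qed.

Lemma aut_orbit_refl A : aut_orbit A A.
Proof.
have [f fa fE] := @inner_aut 1 1 (mulr1 _) (mulr1 _).
exists f => //; apply/vspaceP => x; apply/idP/memv_imgP => [xA|[y yA ->]].
  by exists x => //; rewrite fE mul1r mulr1.
by rewrite fE mul1r mulr1.
Qed.

Lemma aut_orbit_sym A A' : aut_orbit A A' -> aut_orbit A' A.
Proof.
case=> f fa ->; have [f' [f'a fK f'K]] := aut_inv fa.
by exists f' => //; rewrite (aut_limg _ fK f'K).
Qed.

Lemma aut_orbit_trans A A' A'' :
  aut_orbit A A' -> aut_orbit A' A'' -> aut_orbit A A''.
Proof.
case=> f fa -> [g ga ->]; have [h ha hE] := aut_comp ga fa.
exists h => //; rewrite -limg_comp; apply: eq_in_limg => x _.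
by rewrite comp_lfunE hE.
Qed.

Lemma AlgGr_aut m f A : is_aut f -> AlgGr m A -> AlgGr m (f @: A)%VS.
Proof.
move=> fa [A1 AA dA]; split; last by rewrite dim_aut_img.
  by rewrite -(rmorph1 f); apply: memv_img.
by rewrite -aimgM; apply: limgS.
Qed.

End Automorphisms.

(** * Hyperplanes of the image and subspaces of codimension 1 in the source *)

Section Hyperplanes.
Variables (k : fieldType) (U V : vectType k) (f : 'Hom(U, V)).
Implicit Types (A : {vspace U}) (W : {vspace V}).

Lemma preim_img A : (lker f <= A)%VS -> (f @^-1: (f @: A))%VS = A.
Proof.
move=> sA; apply/vspaceP => x; rewrite -memv_preim.
apply/idP/idP => [/memv_imgP[y yA e]|]; last exact: memv_img.
rewrite -[x](subrK y) memvD //; apply: (subvP sA).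
by rewrite memv_ker linearB /= e subrr.
Qed.

Lemma dim_codim_img A : (lker f <= A)%VS ->
  (\dim (f @: A) + \dim (lker f) = \dim A)%N.
Proof.
by move=> sA; rewrite addnC -(limg_ker_dim f A); move/capv_idPr: sA => ->.
Qed.

Lemma hyperplane_img A : (0 < \dim {:U})%N -> (lker f <= A)%VS ->
  \dim A = (\dim {:U} - 1)%N -> hyperplane_of (limg f) (f @: A)%VS.
Proof.
move=> d0 sA dA; split; first exact/limgS/subvf.
apply/eqP; rewrite -(eqn_add2r (\dim (lker f))) addSn dim_codim_img //.
by rewrite (dim_codim_img (subvf _)) dA subn1 prednK.
Qed.

Lemma hyperplane_preim W : hyperplane_of (limg f) W ->
  (f @: (f @^-1: W))%VS = W /\ \dim (f @^-1: W) = (\dim {:U} - 1)%N.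
Proof.
case=> sW dW; have fW := lpreimK sW; split=> //.
have sk : (lker f <= f @^-1: W)%VS by rewrite -lpreim0 lpreimS ?sub0v.
rewrite -(dim_codim_img sk) -(dim_codim_img (subvf _)) fW.
by rewrite -[\dim (limg f)]dW addSn subn1.
Qed.

End Hyperplanes.

(** Some weight is nonzero because the sum is 1; orthogonality then kills all the others, and the
    sum makes it 1. *)
Lemma orthogonal_weights (k : fieldType) (V : finType) (l : V -> k) :
  \sum_w l w = 1 -> (forall w w', w != w' -> l w * l w' = 0) ->
  exists u, forall w, l w = (w == u)%:R.
Proof.
move=> l1 l0; have [u lu] : exists u, l u != 0.
  apply/existsP; apply: contraT => /existsPn z.
  have := oner_neq0 k; rewrite -l1 big1 ?eqxx // => w _.
  by apply/eqP; move: (z w); rewrite negbK.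
have luw w : w != u -> l w = 0.
  by move=> ne; apply/(mulIf lu); rewrite mul0r l0.
exists u => w; case: eqVneq => [->|/luw //].
by rewrite -l1 (bigD1 u) //= big1 ?addr0.
Qed.

(** * Finite covers by orbits *)

Section FiniteUnions.
Variables (T : eqType) (orb : T -> T -> Prop).

(** Unlike in [finite_union_of_orbits], the orbits may leave [X], so that [X] can be cut into cases
    that are not stable under [orb]. *)
Definition finitely_covered (X : T -> Prop) : Prop :=
  exists2 s : seq T, (forall y, y \in s -> X y) &
    forall x, X x -> exists2 y, y \in s & orb y x.

Lemma finite_union_covered X : (forall x y, X x -> orb x y -> X y) ->
  finitely_covered X -> finite_union_of_orbits orb X.
Proof.
move=> Xorb [s sX Xs]; exists s => x; split=> [/Xs //|[y ys]].
exact/Xorb/sX.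
Qed.

Lemma finitely_covered_one X :
  (forall x y, X x -> X y -> orb x y) -> finitely_covered X.
Proof.
move=> XX; case: (classic (exists x, X x)) => [[x Xx]|no].
  exists [:: x] => [y|y Xy]; first by rewrite inE => /eqP->.
  by exists x; rewrite ?mem_head //; apply: XX.
by exists [::] => // x Xx; case: no; exists x.
Qed.

Lemma finitely_covered_cases (I : eqType) (s : seq I) (C : I -> T -> Prop) X :
  (forall x, X x -> exists2 i, i \in s & C i x) ->
  (forall i, i \in s -> finitely_covered (fun x => X x /\ C i x)) ->
  finitely_covered X.
Proof.
elim: s X => [|i s IH] X cov fin; first by exists [::] => // x /cov[].
have [s1 s1X Xs1] := fin i (mem_head _ _).
have [x Xx|j js|s2 s2X Xs2] := IH (fun x => X x /\ exists2 j, j \in s & C j x).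
- by case: Xx.
- have jis : j \in i :: s by rewrite inE js orbT.
  have [s' sX Xs] := fin j jis; exists s' => [y|x [[Xx _] Cx]].
    by move=> /sX[Xy Cy]; split=> //; split=> //; exists j.
  exact: Xs.
exists (s1 ++ s2) => [y|x Xx].
  by rewrite mem_cat => /orP[/s1X[]|/s2X[]].
case: (cov x Xx) => j; rewrite inE => /predU1P[->|js] Cx.
  by have [//|y ys o] := Xs1 x; exists y; rewrite // mem_cat ys.
have [|y ys o] := Xs2 x; first by split=> //; exists j.
by exists y; rewrite // mem_cat ys orbT.
Qed.

End FiniteUnions.

Lemma linear_mull (k : fieldType) (B : falgType k) (a : B) :
  linear (fun x : B => a * x).
Proof. by move=> c x y; rewrite mulrDr scalerAr. Qed.

Lemma linear_mulr (k : fieldType) (B : falgType k) (a : B) :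
  linear (fun x : B => x * a).
Proof. by move=> c x y; rewrite mulrDl scalerAl. Qed.

(** * Complete orthogonal idempotents with dual characters whose common kernel is the radical *)

Section BasicAlgebra.
Variables (k : fieldType) (B : falgType k) (V : finType).
Variables (e : V -> B) (chi : V -> B -> k).
Local Notation J := (jacobson B).
Hypothesis idemM : forall u v, e u * e v = (u == v)%:R *: e u.
Hypothesis idem1 : \sum_u e u = 1.
Hypothesis chi_linear : forall u (a : k) x y,
  chi u (a *: x + y) = a * chi u x + chi u y.
Hypothesis chi_idem : forall u w, chi u (e w) = (w == u)%:R.
Hypothesis chiM : forall u x y, chi u (x * y) = chi u x * chi u y.
Hypothesis memJ : forall x, x \in J <-> (forall u, chi u x = 0).
Hypothesis J_nil : forall x, x \in J -> exists n, x ^+ n = 0.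
Implicit Types (u v w : V) (x y b : B) (A : {vspace B}) (f : 'AEnd(B)).
Implicit Types (W : {vspace BmodJ2 B}).

Lemma chiD u x y : chi u (x + y) = chi u x + chi u y.
Proof. by rewrite -{1}[x]scale1r chi_linear mul1r. Qed.

Lemma chi0 u : chi u 0 = 0.
Proof. by apply: (addrI (chi u 0)); rewrite -chiD !addr0. Qed.

Lemma chiZ u a x : chi u (a *: x) = a * chi u x.
Proof. by rewrite -{1}[a *: x]addr0 chi_linear chi0 addr0. Qed.

Lemma chiB u x y : chi u (x - y) = chi u x - chi u y.
Proof. by rewrite -scaleN1r chiD chiZ mulN1r. Qed.

Lemma chi_sum u (I : finType) (F : I -> B) :
  chi u (\sum_i F i) = \sum_i chi u (F i).
Proof. exact: (big_morph _ (chiD u) (chi0 u)). Qed.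

Lemma chi1 u : chi u 1 = 1.
Proof.
rewrite -idem1 chi_sum (bigD1 u) //= chi_idem eqxx big1 ?addr0 // => w ne.
by rewrite chi_idem (negbTE ne).
Qed.

Lemma chiX u x n : chi u (x ^+ n) = chi u x ^+ n.
Proof. by elim: n => [|n IH]; rewrite ?expr0 ?chi1 // !exprS chiM IH. Qed.

Lemma JMl a x : x \in J -> a * x \in J.
Proof. by move=> /memJ x0; apply/memJ => u; rewrite chiM x0 mulr0. Qed.

Lemma JMr a x : x \in J -> x * a \in J.
Proof. by move=> /memJ x0; apply/memJ => u; rewrite chiM x0 mul0r. Qed.

(** Elements of [J] are nilpotent, [f] preserves nilpotency, and a nilpotent value of a character is
    zero in the field. *)
Lemma aut_J f x : x \in J -> f x \in J.
Proof.
move=> /J_nil[n xn]; apply/memJ => u; apply/eqP.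
have : chi u (f x ^+ n) == 0 by rewrite -rmorphXn /= xn linear0 chi0.
by rewrite chiX expf_eq0 => /andP[].
Qed.

(** The projection onto [J] along the span of the vertices. *)
Definition radical_part b : B := b - \sum_w chi w b *: e w.

Lemma radical_partJ b : radical_part b \in J.
Proof.
apply/memJ => u; rewrite chiB chi_sum (bigD1 u) //= chiZ chi_idem eqxx mulr1.
rewrite big1 ?addr0 ?subrr // => w ne.
by rewrite chiZ chi_idem (negbTE ne) mulr0.
Qed.

Lemma radical_part_id b : b \in J -> radical_part b = b.
Proof.
move=> /memJ b0; rewrite /radical_part big1 ?subr0 // => w _.
by rewrite b0 scale0r.
Qed.

Lemma radical_part_idem w : radical_part (e w) = 0.
Proof.
rewrite /radical_part (bigD1 w) //= chi_idem eqxx scale1r big1 ?addr0 ?subrr //.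
by move=> u ne; rewrite chi_idem eq_sym (negbTE ne) scale0r.
Qed.

Lemma radical_part_linear : linear radical_part.
Proof.
move=> a x y; rewrite /radical_part scalerBr scaler_sumr addrACA -opprD.
congr (_ - _); rewrite -big_split; apply: eq_bigr => w _.
by rewrite chi_linear scalerDl scalerA.
Qed.

Lemma idem_sum_l u b : e u * (\sum_w chi w b *: e w) = chi u b *: e u.
Proof.
rewrite mulr_sumr (bigD1 u) //= -scalerAr idemM eqxx scale1r.
rewrite big1 ?addr0 // => w ne.
by rewrite -scalerAr idemM eq_sym (negbTE ne) scale0r scaler0.
Qed.

Lemma idem_sum_r u b : (\sum_w chi w b *: e w) * e u = chi u b *: e u.
Proof.
rewrite mulr_suml (bigD1 u) //= -scalerAl idemM eqxx scale1r.
rewrite big1 ?addr0 // => w ne.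
by rewrite -scalerAl idemM (negbTE ne) scale0r scaler0.
Qed.

Lemma idem_l u b : e u * b = chi u b *: e u + e u * radical_part b.
Proof. by rewrite mulrBr idem_sum_l addrC subrK. Qed.

Lemma idem_r u b : b * e u = chi u b *: e u + radical_part b * e u.
Proof. by rewrite mulrBl idem_sum_r addrC subrK. Qed.

(** * The maps from B to the spaces u(J/J^2)v, and preimages of hyperplanes *)

Lemma arrow_part_linear u v :
  linear (fun b => quotv_pi (J * J)%VS (e u * radical_part b * e v)).
Proof.
move=> a x y; rewrite radical_part_linear mulrDr mulrDl -scalerAr -scalerAl.
by rewrite linearP.
Qed.

(* [arrow_part u v] is a derivation through the characters of [u] and
   [v], so that the preimage of a hyperplane is a subalgebra. *)
Definition arrow_part u v : 'Hom(B, BmodJ2 B) := lfun_of (arrow_part_linear u v).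

Lemma arrow_partE u v b :
  arrow_part u v b = quotv_pi (J * J)%VS (e u * radical_part b * e v).
Proof. exact: lfun_ofE. Qed.

Lemma arrow_part_eq0 u v b :
  (arrow_part u v b == 0) = (e u * radical_part b * e v \in (J * J)%VS).
Proof. by rewrite arrow_partE quotv_pi_eq0. Qed.

Lemma arrow_part_idem u v w : arrow_part u v (e w) = 0.
Proof. by rewrite arrow_partE radical_part_idem mulr0 mul0r linear0. Qed.

Lemma arrow_part1 u v : arrow_part u v 1 = 0.
Proof.
rewrite -idem1 linear_sum big1 // => w _; exact: arrow_part_idem.
Qed.

(** Write [e u * x] and [y * e v] as a multiple of a vertex plus a radical term. In their product
    the vertex term [p * q] is the one that [radical_part (x * y)] removes, the product of the two
    radical terms lies in [J * J], and the two mixed terms remain. *)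
Lemma arrow_partM u v x y : arrow_part u v (x * y) =
  chi u x *: arrow_part u v y + chi v y *: arrow_part u v x.
Proof.
apply/eqP; rewrite !arrow_partE -subr_eq0 -!linearZ -linearD -linearB /=.
rewrite quotv_pi_eq0; set rx := radical_part x; set ry := radical_part y.
pose p := chi u x *: e u; pose q := chi v y *: e v.
have -> : e u * radical_part (x * y) * e v =
    (p + e u * rx) * (q + ry * e v) - p * q.
  rewrite -idem_l -idem_r mulrBr mulrBl idem_sum_l !mulrA; congr (_ - _).
  rewrite /p /q -!scalerAl -scalerAr idemM chiM.
  by case: eqVneq => [->|_]; rewrite ?scale0r ?scaler0 ?scale1r ?scalerA.
have -> : chi u x *: (e u * ry * e v) + chi v y *: (e u * rx * e v) =
    p * (ry * e v) + e u * rx * q.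
  by rewrite /p /q -scalerAl -scalerAr mulrA.
have group_id (a b c d : B) : a + b + (c + d) - a - (b + c) = d.
  by rewrite -(addrA a b) [a + _]addrC addrK addrA [_ + d]addrC addrK.
rewrite (mulrDl p) !(mulrDr _ q) group_id.
by apply: memv_mul; [apply: JMl | apply: JMr]; apply: radical_partJ.
Qed.


Lemma arrow_space_limg u v : arrow_space (e u) (e v) = limg (arrow_part u v).
Proof.
apply/vspaceP => y; apply/memv_imgP/memv_imgP => [[x xU ->]|[b _ ->]].
  exists x; first exact: memvf.
  have [z zJ ->] : exists2 z, z \in J & x = e u * z * e v.
    move/memv_cosetP: xU => [a aU ->]; move: aU.
    have sub : (<[e u]> * J <= lfun_of (linear_mull (e u)) @: J)%VS.
      apply/prodvP => _ z /vlineP[c ->] zJ; apply/memv_imgP.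
      by exists (c *: z); rewrite ?memvZ // lfun_ofE -scalerAl -scalerAr.
    move/(subvP sub)/memv_imgP => [z zJ ->].
    by exists z => //; rewrite lfun_ofE.
  rewrite arrow_partE radical_part_id; last by apply: JMr; apply: JMl.
  by rewrite !mulrA idemM eqxx scale1r -!mulrA idemM eqxx scale1r.
exists (e u * radical_part b * e v); last exact: arrow_partE.
by rewrite !memv_mul ?memv_line ?radical_partJ.
Qed.

Lemma dimB_gt0 : (0 < \dim {:B})%N.
Proof.
rewrite lt0n dimv_eq0; apply/eqP => e0; have := memvf (1 : B).
by rewrite e0 memv0 oner_eq0.
Qed.

Local Notation n := (\dim {:B}).
Local Notation hyperplane u v := (hyperplane_of (arrow_space (e u) (e v))).

Lemma AlgGr_preim u v W : hyperplane u v W ->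
  AlgGr (n - 1) (arrow_part u v @^-1: W)%VS.
Proof.
rewrite arrow_space_limg => hW; split; last by case: (hyperplane_preim hW).
  by rewrite -memv_preim arrow_part1 mem0v.
apply: subalgP => x y; rewrite -!memv_preim arrow_partM => xW yW.
by rewrite memvD ?memvZ.
Qed.

Lemma preim_arrow_part u v A : \dim A = (n - 1)%N ->
  (lker (arrow_part u v) <= A)%VS ->
  hyperplane u v (arrow_part u v @: A)%VS /\
  (arrow_part u v @^-1: (arrow_part u v @: A))%VS = A.
Proof.
move=> dA sA; split; last exact: preim_img.
by rewrite arrow_space_limg; apply: hyperplane_img => //; apply: dimB_gt0.
Qed.

Definition fixes_idem f := is_aut f /\ forall u, f (e u) = e u.

(** Such an [f] preserves [J] and fixes the span of the vertices, hence respects the decomposition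
    behind [radical_part]. *)
Lemma fixes_idem_chi f u b : fixes_idem f -> chi u (f b) = chi u b.
Proof.
move=> [_ fe]; have fr : f (radical_part b) \in J.
  by apply: aut_J; apply: radical_partJ.
have -> : f b = f (radical_part b) + \sum_w chi w b *: e w.
  rewrite -{1}[b](subrK (\sum_w chi w b *: e w)) linearD /=; congr (_ + _).
  by rewrite linear_sum; apply: eq_bigr => w _; rewrite linearZ /= fe.
rewrite chiD (proj1 (memJ _) fr) add0r chi_sum (bigD1 u) //= chiZ chi_idem.
rewrite eqxx mulr1 big1 ?addr0 // => w ne.
by rewrite chiZ chi_idem (negbTE ne) mulr0.
Qed.

Lemma arrow_part_fixes f u v b : fixes_idem f ->
  arrow_part u v (f b) = quotv_map (J * J)%VS f (arrow_part u v b).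
Proof.
move=> ff; have [fa fe] := ff.
rewrite !arrow_partE quotv_mapE ?aut_jacobson2 // !rmorphM /= !fe.
congr (quotv_pi _ (_ * _ * _)); rewrite linearB linear_sum /=; congr (_ - _).
by apply: eq_bigr => w _; rewrite linearZ /= fe fixes_idem_chi.
Qed.

Lemma fixes_idem_inv f : fixes_idem f ->
  exists f', [/\ fixes_idem f', cancel f f' & cancel f' f].
Proof.
move=> [fa fe]; have [f' [f'a fK f'K]] := aut_inv fa.
by exists f'; split=> //; split=> // u; rewrite -{1}(fe u) fK.
Qed.

Lemma fixes_preim f u v W : fixes_idem f -> hyperplane u v W ->
  hyperplane u v (quotv_map (J * J)%VS f @: W)%VS /\
  (arrow_part u v @^-1: (quotv_map (J * J)%VS f @: W))%VS =
  (f @: (arrow_part u v @^-1: W))%VS.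
Proof.
move=> ff hW; have [f' [f'f fK f'K]] := fixes_idem_inv ff.
have [_ _ dA] := AlgGr_preim hW; have [fa _] := ff.
have /hyperplane_preim[WE _] : hyperplane_of (limg (arrow_part u v)) W.
  by rewrite -arrow_space_limg.
set A := (_ @^-1: W)%VS in dA WE *.
have imE : (quotv_map (J * J) f @: W = arrow_part u v @: (f @: A))%VS.
  rewrite -WE -!limg_comp; apply: eq_in_limg => b _.
  by rewrite [LHS]comp_lfunE [RHS]comp_lfunE arrow_part_fixes.
rewrite imE; apply: preim_arrow_part; first by rewrite dim_aut_img.
(* The inverse [f'] also fixes the vertices, so it maps the kernel of [arrow_part u v] into itself,
   hence into [A]. *)
apply/subvP => b; rewrite memv_ker => /eqP b0; apply/memv_imgP.
exists (f' b); rewrite ?f'K // -memv_preim arrow_part_fixes // b0 linear0.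
exact: mem0v.
Qed.

(** [arrow_part u v] maps the preimage of a hyperplane back onto it, so a hyperplane is determined
    by its preimage. *)
Lemma preim_fixes f u v W W' : fixes_idem f ->
  hyperplane u v W -> hyperplane u v W' ->
  (f @: (arrow_part u v @^-1: W))%VS = (arrow_part u v @^-1: W')%VS ->
  W' = (quotv_map (J * J)%VS f @: W)%VS.
Proof.
move=> ff hW hW'; have [hfW <-] := fixes_preim ff hW.
move: hW' hfW; rewrite arrow_space_limg => /hyperplane_preim[EW' _].
by move=> /hyperplane_preim[EW _] eqA; rewrite -EW' -eqA EW.
Qed.


(** * The permutation of the vertices induced by an automorphism *)

Lemma char_endo f u : exists v, forall w, chi u (f (e w)) = (w == v)%:R.
Proof.
apply: orthogonal_weights => [|w w' ne].
  by rewrite -chi_sum -linear_sum idem1 rmorph1 chi1.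
by rewrite -chiM -rmorphM /= idemM (negbTE ne) scale0r linear0 chi0.
Qed.

(** Since [f] preserves [J], composing [chi v] with [f] gives [chi (t v)]. If [t v = t v'], then
    [chi v] and [chi v'] agree on the image of [f], which is all of [B], in particular at [e v]. *)
Lemma char_aut f : is_aut f -> exists2 t : {ffun V -> V}, injective t &
  forall v w, chi v (f (e w)) = (w == t v)%:R.
Proof.
move=> [f' _ f'K]; have [t tE] := fin_all_exists (char_endo f).
exists [ffun v => t v] => [v v'|v w]; last by rewrite ffunE.
rewrite !ffunE => tvv'; apply/eqP.
have same b : chi v (f b) = chi v' (f b).
  have fJ u : chi u (f (radical_part b)) = 0.
    by move: u; apply/memJ/aut_J/radical_partJ.
  have -> : f b = f (radical_part b) + f (\sum_w chi w b *: e w).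
    by rewrite -linearD subrK.
  rewrite !chiD !fJ !add0r.
  rewrite !linear_sum !chi_sum; apply: eq_bigr => w _.
  by rewrite !linearZ /= !chiZ !tE tvv'.
have := same (f' (e v)); rewrite !f'K !chi_idem eqxx.
by case: eqVneq => // _ /eqP; rewrite oner_eq0.
Qed.

(* [g = \sum_v f (e (t v)) * e v] is a unit of the subalgebra [A'], congruent
   to [1] modulo the radical, and intertwines the two systems of idempotents. *)
Lemma aut_straighten f A A' : is_aut f -> AlgGr (n - 1) A' ->
  (forall v, e v \in A) -> (forall v, e v \in A') -> (f @: A)%VS = A' ->
  exists t : {ffun V -> V}, exists f',
    [/\ is_aut f', (f' @: A)%VS = A' & forall v, f' (e (t v)) = e v].
Proof.
move=> fa [A1 AA dA] eA eA' fA; have [t t_inj tE] := char_aut fa.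
pose g := \sum_v f (e (t v)) * e v.
have gA : g \in A'.
  by apply: memv_suml => v _; apply: subalgM => //; rewrite -fA memv_img.
have gJ : 1 - g \in J.
  apply/memJ => u; rewrite chiB chi1 chi_sum (bigD1 u) //= chiM chi_idem tE.
  rewrite !eqxx mulr1 big1 ?addr0 ?subrr // => w ne.
  by rewrite chiM chi_idem (negbTE ne) mulr0.
have [m gm] := J_nil gJ; have [] := nilp_inv gm.
rewrite subKr; set g' := \sum_(i < m) _ => gg' g'g.
have g'A : g' \in A'.
  by apply: memv_suml => i _; apply: subalgX => //; rewrite memvB.
have fg v : f (e (t v)) * g = g * e v.
  rewrite mulr_sumr mulr_suml; apply: eq_bigr => w _.
  rewrite mulrA -rmorphM /= idemM (inj_eq t_inj) -mulrA idemM.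
  by case: eqVneq => [->|_]; rewrite ?scale1r // !scale0r linear0 mul0r mulr0.
(* Conjugation by the inverse of [g] maps [f (e (t v))] to [e v] by [fg], and preserves [A'] because
   [g] and [g'] lie in it. *)
have [h ha hE] := inner_aut g'g gg'; have [f' f'a f'E] := aut_comp ha fa.
exists t, f'; split=> // [|v]; last first.
  by rewrite f'E hE -mulrA fg mulrA g'g mul1r.
apply/eqP; rewrite eqEdim dim_aut_img // -(dim_aut_img A fa) fA leqnn andbT.
apply/subvP => _ /memv_imgP[x xA ->]; rewrite f'E hE.
by do 2![apply: subalgM => //]; rewrite -fA memv_img.
Qed.


(** * Subalgebras of codimension 1 containing the radical *)

(** With [e u] outside [A], the scalars [c w] such that [e w - c w *: e u] lies in [A] define a
    functional with kernel [A]. Products of these elements show that at most one [c v] with [v != u]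
    is nonzero, and [1] in [A] forces [c v = - c u = -1]. *)
Lemma codim1_above_J A : AlgGr (n - 1) A -> (J <= A)%VS ->
  exists u v, forall x, (x \in A) = (chi u x == chi v x).
Proof.
move=> [A1 AA dA] JA.
have [u uA] : exists u, e u \notin A.
  apply/existsP; apply: contraT => /existsPn eA.
  have Af : A = fullv.
    apply/vspaceP => x; rewrite memvf.
    rewrite -[x](subrK (\sum_w chi w x *: e w)) memvD //.
      exact: (subvP JA _ (radical_partJ x)).
    by apply: memv_suml => w _; rewrite memvZ //; move: (eA w); rewrite negbK.
  (* The subtraction is truncated, so [0 < n] is what excludes [n = n - 1]. *)
  move: dimB_gt0 dA; rewrite Af; case: (\dim {:B}) => // d _ /eqP.
  by rewrite subn1 /= gtn_eqF.
have /fin_all_exists[c cE] w := codim1_decomp dA uA (e w).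
have c_eq0 (a : k) : a *: e u \in A -> a = 0.
  by rewrite rpredZeq (negbTE uA) orbF => /eqP.
have modA x : x - (\sum_w chi w x * c w) *: e u \in A.
  have -> : x - (\sum_w chi w x * c w) *: e u =
      radical_part x + \sum_w chi w x *: (e w - c w *: e u).
    rewrite -{1}[x](subrK (\sum_w chi w x *: e w)) -addrA; congr (_ + _).
    rewrite scaler_suml -sumrB; apply: eq_bigr => w _.
    by rewrite scalerBr scalerA.
  apply: memvD; first by apply: (subvP JA); apply: radical_partJ.
  by apply: memv_suml => w _; rewrite memvZ.
have memA x : (x \in A) = (\sum_w chi w x * c w == 0).
  apply/idP/eqP => [xA|x0]; last by have := modA x; rewrite x0 scale0r subr0.
  by apply: c_eq0; rewrite -[_ *: _](subKr x) memvB.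
have cu : c u = 1.
  apply/eqP; rewrite -subr_eq0 -oppr_eq0 opprB; apply/eqP/c_eq0.
  by rewrite scalerBl scale1r.
have c_orth w w' : w != w' -> w != u -> w' != u -> c w * c w' = 0.
  move=> ne wu w'u; apply: c_eq0.
  have := subalgM AA (cE w) (cE w').
  rewrite mulrBl !mulrBr -!scalerAl -!scalerAr !idemM eqxx (negbTE ne).
  rewrite (negbTE wu) eq_sym (negbTE w'u).
  by rewrite !(scale0r, scaler0, oppr0, sub0r, opprK) scale1r scalerA.
have c_sum : \sum_w c w = 0.
  move: A1; rewrite memA => /eqP sum0; rewrite -[RHS]sum0.
  by apply: eq_bigr => w _; rewrite chi1 mul1r.
have [v /andP[vu cv]] : exists v, (v != u) && (c v != 0).
  apply/existsP; apply: contraT => /existsPn z; have := oner_neq0 k.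
  rewrite -cu -c_sum (bigD1 u) //= big1 ?addr0 ?eqxx // => w wu.
  by apply/eqP; move: (z w); rewrite wu negbK.
have c0 w : w != u -> w != v -> c w = 0.
  by move=> wu wv; apply: (mulIf cv); rewrite mul0r c_orth.
have cv1 : c v = -1.
  move: c_sum; rewrite (bigD1 u) //= (bigD1 v) //= cu big1 ?addr0.
    by move/eqP; rewrite addrC addr_eq0 => /eqP.
  by move=> w /andP[wu wv]; apply: c0.
exists u, v => x; rewrite memA (bigD1 u) //= (bigD1 v) //= cu cv1 big1 ?addr0.
  by rewrite mulr1 mulrN1 subr_eq0.
by move=> w /andP[wu wv]; rewrite c0 ?mulr0.
Qed.

(** * Subalgebras of codimension 1 not containing the radical *)

(** Modulo [M], [x] is an eigenvector of [L] with eigenvalue [c], so [c ^+ m *: x] is congruent to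
    the [m]-th iterate, which is zero. *)
Lemma nilp_scalar (L : 'End(B)) (M : {vspace B}) x (c : k) m :
  iter m L x = 0 -> x \notin M -> (forall z, z \in M -> L z \in M) ->
  L x - c *: x \in M -> c = 0.
Proof.
move=> Lm xM LM Lx; apply/eqP.
suff : c ^+ m *: x \in M.
  by rewrite rpredZeq expf_eq0 (negbTE xM) orbF => /andP[].
rewrite -memvN -[- _]add0r -Lm; elim: {Lm} m => [|m IH] /=.
  by rewrite expr0 scale1r subrr mem0v.
have := memvD (LM _ IH) (memvZ (c ^+ m) Lx).
by rewrite linearB linearZ /= scalerBr scalerA -exprSr addrA subrK.
Qed.

Section CapIdeal.
Variables (A : {vspace B}) (x : B).
Hypotheses (grA : AlgGr (n - 1) A) (xJ : x \in J) (xA : x \notin A).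
Local Notation M := (A :&: J)%VS.

Lemma cap_decomp y : y \in J -> exists c : k, y - c *: x \in M.
Proof.
move=> yJ; have [_ _ dA] := grA; have [c yA] := codim1_decomp dA xA y.
by exists c; rewrite memv_cap yA memvB ?memvZ.
Qed.

Lemma cap_scalar (c : k) : c *: x \in A -> c = 0.
Proof. by rewrite rpredZeq (negbTE xA) orbF => /eqP. Qed.

Lemma cap_notin : x \notin M.
Proof. by rewrite memv_cap (negbTE xA). Qed.

Lemma capM y z : y \in M -> z \in M -> y * z \in M.
Proof.
rewrite !memv_cap => /andP[yA yJ] /andP[zA zJ]; rewrite JMl // andbT.
by have [_ AA _] := grA; apply: subalgM.
Qed.

(** The quotient of [J] by [M] is a line spanned by [x]; left multiplication by the nilpotent [y]
    acts on it by a scalar, which must be zero. *)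
Lemma cap_mull y : y \in J -> (forall z, z \in M -> y * z \in M) -> y * x \in M.
Proof.
move=> yJ yM; have [m ym] := J_nil yJ; have [c yx] := cap_decomp (JMl y xJ).
suff c0 : c = 0 by move: yx; rewrite c0 scale0r subr0.
apply: (@nilp_scalar (lfun_of (linear_mull y)) M x c m _ cap_notin).
- rewrite -(mul0r x) -ym; elim: {ym} m => [|m IH]; first by rewrite /= mul1r.
  by rewrite iterS IH lfun_ofE mulrA -exprS.
- by move=> z zM; rewrite lfun_ofE yM.
- by rewrite lfun_ofE.
Qed.

Lemma cap_mulr y : y \in J -> (forall z, z \in M -> z * y \in M) -> x * y \in M.
Proof.
move=> yJ yM; have [m ym] := J_nil yJ; have [c yx] := cap_decomp (JMr y xJ).
suff c0 : c = 0 by move: yx; rewrite c0 scale0r subr0.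
apply: (@nilp_scalar (lfun_of (linear_mulr y)) M x c m _ cap_notin).
- rewrite -(mulr0 x) -ym; elim: {ym} m => [|m IH]; first by rewrite /= mulr1.
  by rewrite iterS IH lfun_ofE -mulrA -exprSr.
- by move=> z zM; rewrite lfun_ofE yM.
- by rewrite lfun_ofE.
Qed.

(** First step of a bootstrap: [M] is closed under products, so its elements stabilise [M] and kill
    the line spanned by [x] modulo [M]. *)
Lemma cap_Mx m : m \in M -> m * x \in M.
Proof.
move=> mM; apply: cap_mull => [|z]; last exact: capM.
by move: mM; rewrite memv_cap => /andP[].
Qed.

Lemma cap_xM m : m \in M -> x * m \in M.
Proof.
move=> mM; apply: cap_mulr => [|z zM]; last exact: capM.
by move: mM; rewrite memv_cap => /andP[].
Qed.

(** By [cap_xM], [x] itself now stabilises [M], so [cap_mull] applies to it. *)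
Lemma cap_xx : x * x \in M.
Proof. by apply: cap_mull => // z; apply: cap_xM. Qed.

Lemma cap_JJ : (J * J <= M)%VS.
Proof.
apply/prodvP => y z /cap_decomp[c yM] /cap_decomp[d zM].
rewrite -[y](subrK (c *: x)) -[z](subrK (d *: x)).
move: (y - _) (z - _) yM zM => p q pM qM; rewrite mulrDl !mulrDr.
rewrite -!scalerAl -!scalerAr; do !apply: memvD; do ?apply: memvZ.
- exact: capM.
- exact: cap_Mx.
- exact: cap_xM.
- exact: cap_xx.
Qed.

Lemma cap_ideall b m : m \in M -> b * m \in M.
Proof.
move=> mM; have [_ AA dA] := grA; have [c bA] := codim1_decomp dA xA b.
rewrite -[b](subrK (c *: x)) mulrDl memvD //.
  move: mM; rewrite !memv_cap => /andP[mA mJ].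
  by rewrite subalgM ?JMl.
by rewrite -scalerAl memvZ ?cap_xM.
Qed.

Lemma cap_idealr b m : m \in M -> m * b \in M.
Proof.
move=> mM; have [_ AA dA] := grA; have [c bA] := codim1_decomp dA xA b.
rewrite -[b](subrK (c *: x)) mulrDr memvD //.
  move: mM; rewrite !memv_cap => /andP[mA mJ].
  by rewrite subalgM ?JMr.
by rewrite -scalerAr memvZ ?cap_Mx.
Qed.

Lemma cap_scalarM (c : k) : c *: x \in M -> c = 0.
Proof. by rewrite memv_cap => /andP[/cap_scalar]. Qed.

(** The vertices act on the left of the line [J] modulo [M] by scalars, which inherit orthogonality
    and sum 1 from the idempotents. *)
Lemma cap_weightl : exists u, forall w, e w * x - (w == u)%:R *: x \in M.
Proof.
have /fin_all_exists[l lE] w := cap_decomp (JMl (e w) xJ).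
have [|w w' ne|u lu] := @orthogonal_weights k V l.
- apply/eqP; rewrite -subr_eq0 -oppr_eq0 opprB; apply/eqP/cap_scalarM.
  have <- : \sum_w (e w * x - l w *: x) = (1 - \sum_w l w) *: x.
    by rewrite sumrB -mulr_suml idem1 mul1r scalerBl scale1r scaler_suml.
  by apply: memv_suml.
- apply: cap_scalarM; rewrite -memvN.
  have := memvD (cap_ideall (e w) (lE w')) (memvZ (l w') (lE w)).
  rewrite mulrBr mulrA idemM (negbTE ne) scale0r mul0r sub0r -scalerAr.
  by rewrite scalerBr addKr scalerA mulrC.
by exists u => w; rewrite -lu.
Qed.

Lemma cap_weightr : exists v, forall w, x * e w - (w == v)%:R *: x \in M.
Proof.
have /fin_all_exists[l lE] w := cap_decomp (JMr (e w) xJ).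
have [|w w' ne|u lu] := @orthogonal_weights k V l.
- apply/eqP; rewrite -subr_eq0 -oppr_eq0 opprB; apply/eqP/cap_scalarM.
  have <- : \sum_w (x * e w - l w *: x) = (1 - \sum_w l w) *: x.
    by rewrite sumrB -mulr_sumr idem1 mulr1 scalerBl scale1r scaler_suml.
  by apply: memv_suml.
- apply: cap_scalarM; rewrite -memvN.
  have := memvD (cap_idealr (e w') (lE w)) (memvZ (l w) (lE w')).
  rewrite mulrBl -mulrA idemM (negbTE ne) scale0r mulr0 sub0r -scalerAl.
  by rewrite scalerBr addKr scalerA.
by exists u => w; rewrite -lu.
Qed.

(** Take for [u] and [v] the left and right weights of [x]. If [radical_part b] is [c *: x] modulo
    [M], so is [e u * radical_part b * e v]. For [b] in the kernel of [arrow_part u v] the latter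
    lies in [J * J], hence in [M]; so [c = 0] and [b] is in [A]. *)
Lemma preim_of_idem : (forall w, e w \in A) -> exists u v W,
  hyperplane u v W /\ (arrow_part u v @^-1: W)%VS = A.
Proof.
move=> eA; have [_ AA dA] := grA.
have [u lu] := cap_weightl; have [v rv] := cap_weightr.
exists u, v, (arrow_part u v @: A)%VS; apply: preim_arrow_part => //.
apply/subvP => b; rewrite memv_ker arrow_part_eq0 => /(subvP cap_JJ).
have [c] := cap_decomp (radical_partJ b).
set m := _ - _ => mM.
have mE : radical_part b = m + c *: x by rewrite subrK.
have uxv : e u * x * e v - x \in M.
  have := memvD (cap_idealr (e v) (lu u)) (rv v).
  by rewrite !eqxx !scale1r mulrBl addrA subrK.
rewrite mE mulrDr mulrDl -scalerAr -scalerAl => sM.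
have c0 : c = 0.
  apply: cap_scalarM; rewrite -[_ *: _](subKr (c *: (e u * x * e v))).
  rewrite memvB //; last by rewrite -scalerBr memvZ.
  rewrite -[_ *: _](addKr (e u * m * e v)) memvD // memvN.
  by rewrite cap_idealr ?cap_ideall.
rewrite -[b](subrK (\sum_w chi w b *: e w)) memvD //.
  rewrite -/(radical_part b) mE c0 scale0r addr0.
  by move: mM; rewrite memv_cap => /andP[].
by apply: memv_suml => w _; rewrite memvZ.
Qed.

(* Orthogonality of the idempotents makes the deviation [d] of [e] from [A] a
   multiple of the difference of the left and right weights of [x]. *)
Lemma cap_conj_coeff u v (d : V -> k) :
  (forall w, e w * x - (w == u)%:R *: x \in M) ->
  (forall w, x * e w - (w == v)%:R *: x \in M) ->
  (forall w, e w - d w *: x \in A) ->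
  forall w, d w = - d v * ((w == u)%:R - (w == v)%:R).
Proof.
move=> lu rv dE; have [A1 AA _] := grA.
have MA m : m \in M -> m \in A by rewrite memv_cap => /andP[].
(* Expand the product of [e w - d w *: x] and [e w' - d w' *: x], which lies in [A], modulo [M]:
   [e w * e w'] is zero and the mixed terms are multiples of [x] by the weights. *)
have d_rel w w' : w != w' -> d w' * (w == u)%:R + d w * (w' == v)%:R = 0.
  move=> ne; apply: cap_scalar; rewrite scalerDl -memvN opprD.
  have eeA := subalgM AA (dE w) (dE w').
  have luA := memvZ (d w') (MA _ (lu w)).
  have rvA := memvZ (d w) (MA _ (rv w')).
  have xxA := memvZ (d w * d w') (MA _ cap_xx).
  have := memvD (memvB (memvD eeA luA) xxA) rvA.
  rewrite mulrBl !mulrBr -!scalerAl -!scalerAr idemM (negbTE ne) scale0r sub0r.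
  rewrite !scalerBr opprB !scalerA !addrA.
  by rewrite (ACl ((1*4)*(2*6)*(3*7)*5*8)) /= addNr subrr addNr !add0r.
have d_sum : \sum_w d w = 0.
  apply: cap_scalar; rewrite -[_ *: x](subKr 1) memvB //.
  rewrite -idem1 scaler_suml -sumrB.
  by apply: memv_suml.
have dw w : w != v -> d w = - d v * (w == u)%:R.
  move=> wv; have := d_rel w v wv; rewrite eqxx mulr1 addrC => /eqP.
  by rewrite addr_eq0 mulNr => /eqP.
move=> w; case: (eqVneq w v) => [->|wv]; last by rewrite subr0 dw.
case: (eqVneq v u) => [uv|_]; last by rewrite sub0r mulrNN mulr1.
(* If [u = v], all other [d w] vanish, and [d_sum] leaves [d v = 0]. *)
rewrite subrr mulr0 -[LHS]addr0 -[RHS]d_sum (bigD1 v) //= big1 // => z zv.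
by rewrite dw // -uv (negbTE zv) mulr0.
Qed.

(* Modulo [M], conjugation by [1 + c x] adds [c (x e_w - e_w x)] to [e_w]. *)
Lemma conj_idem : exists2 f, is_aut f & forall w, f (e w) \in A.
Proof.
have [_ _ dA] := grA.
have [u lu] := cap_weightl; have [v rv] := cap_weightr.
have /fin_all_exists[d dE] w := codim1_decomp dA xA (e w).
have dw := cap_conj_coeff lu rv dE; set c := - d v in dw.
have MA m : m \in M -> m \in A by rewrite memv_cap => /andP[].
have [m ncx] : exists m, (- (c *: x)) ^+ m = 0.
  by apply: J_nil; rewrite memvN memvZ.
have [] := nilp_inv ncx; set g' := \sum_(i < m) _; rewrite opprK => gg' g'g.
have [f fa fE] := inner_aut gg' g'g; exists f => // w; rewrite fE.
(* The inverse of [1 + c *: x] is [1 - c *: x] up to a multiple of [x * x], so it may be replaced by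
   [1 - c *: x] modulo [M]. *)
have g'M : g' - (1 - c *: x) \in M.
  have g'E : c *: x * g' = 1 - g' by rewrite -gg' mulrDl mul1r addrC addKr.
  have -> : g' - (1 - c *: x) = c *: (c *: (x * x * g')).
    rewrite opprB addrCA -[g' - 1]opprB -g'E -{1}[c *: x]mulr1 -mulrBr -g'E.
    by rewrite -!scalerAl -scalerAr mulrA.
  by rewrite !memvZ // cap_idealr // cap_xx.
rewrite -[g'](subrK (1 - c *: x)) mulrDr memvD //.
  by apply: MA; apply: cap_ideall.
have xexM : x * e w * x \in M by apply: (subvP cap_JJ); rewrite memv_mul // JMr.
have lA := memvZ c (MA _ (lu w)); have rA := memvZ c (MA _ (rv w)).
(* The weight terms of [lA] and [rA] cancel [d w *: x]; what remains is
   [(1 + c *: x) * e w * (1 - c *: x)]. *)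
have := memvB (memvD (memvB (dE w) lA) rA) (memvZ (c * c) (MA _ xexM)).
rewrite dw -scalerA !scalerBl !scalerBr !opprB !addrA.
rewrite (ACl (1*6*(5*8)*(2*7)*(3*4))) /= subrr addNr !addr0.
rewrite mulrBr mulr1 -scalerAr !mulrDl mul1r -!scalerAl scalerDr scalerA.
by rewrite opprD addrA.
Qed.

End CapIdeal.

(** * Classification in codimension 1 and comparison of orbits *)

Lemma codim1_class A : AlgGr (n - 1) A ->
  exists u v, (forall x, (x \in A) = (chi u x == chi v x)) \/
    exists2 W, hyperplane u v W & aut_orbit (arrow_part u v @^-1: W)%VS A.
Proof.
move=> grA; case: (boolP (J <= A)%VS) => [/(codim1_above_J grA)|].
  by case=> u [v A_uv]; exists u, v; left.
case/subvPn=> x xJ xA; have [f fa feA] := conj_idem grA xJ xA.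
have [f' [f'a fK f'K]] := aut_inv fa.
have img y : (y \in f' @: A)%VS = (f y \in A).
  apply/memv_imgP/idP => [[z zA ->]|fyA]; first by rewrite f'K.
  by exists (f y); rewrite ?fK.
have f'xA : f' x \notin (f' @: A)%VS by rewrite img f'K.
have [w|u [v [W [hW WA]]]] :=
  preim_of_idem (AlgGr_aut f'a grA) (aut_J f' xJ) f'xA.
  by rewrite img.
exists u, v; right; exists W => //; rewrite WA.
by exists f => //; rewrite (aut_limg _ f'K fK).
Qed.

(** For [e := vertex_idem pi] this is [HB_orbit] by unfolding. *)
Definition idem_orbit W W' : Prop :=
  exists2 f, fixes_idem f & W' = (quotv_map (J * J)%VS f @: W)%VS.

Lemma idem_orbit_refl W : idem_orbit W W.
Proof.
have [f fa fE] := @inner_aut k B 1 1 (mulr1 _) (mulr1 _).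
have f1 x : f x = x by rewrite fE mul1r mulr1.
exists f; first by split.
have q1 (y : BmodJ2 B) : quotv_map (J * J) f y = y.
  by rewrite -{1}[y]quotv_reprK quotv_mapE ?aut_jacobson2 // f1 quotv_reprK.
apply/vspaceP => y; apply/idP/memv_imgP => [yW|[z zW ->]]; last by rewrite q1.
by exists y.
Qed.

Lemma codim1_subalg_finite :
  finite_union_of_orbits (@aut_orbit k B) (@AlgGr k B (n - 1)) <->
  (forall u v, arrow_space (e u) (e v) <> 0%VS ->
     finite_union_of_orbits idem_orbit (hyperplane u v)).
Proof.
split=> [[s sE] u v _|fin].
  apply: finite_union_covered => [W W' hW [f ff ->]|].
    by have [] := fixes_preim ff hW.
  pose P W := (arrow_part u v @^-1: W)%VS.
  (* Sort the hyperplanes by the automorphism orbit of their preimages. *)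
  apply: (@finitely_covered_cases _ _ _ s (fun A W => aut_orbit A (P W))).
    by move=> W /AlgGr_preim/sE.
  move=> A _.
  case: (classic (exists W, hyperplane u v W /\ aut_orbit A (P W))); last first.
    by move=> no; apply: finitely_covered_one => W W' hW; case: no; exists W.
  move=> [W0 [hW0 AW0]].
  (* Within one class, sort [W] by the map [t] of vertices for a straightened automorphism from
     [P W0] to [P W]. *)
  apply: (@finitely_covered_cases _ _ _ (enum {ffun V -> V}) (fun t W => exists f,
    [/\ is_aut f, (f @: P W0)%VS = P W & forall w, f (e (t w)) = e w])).
    move=> W [hW AW].
    have [f fa /esym fP] := aut_orbit_trans (aut_orbit_sym AW0) AW.
    have eP W' w : e w \in P W' by rewrite -memv_preim arrow_part_idem mem0v.
    have [t [f' f'P]] :=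
      aut_straighten fa (AlgGr_preim hW) (eP W0) (eP W) fP.
    by exists t; [rewrite mem_enum | exists f'].
  move=> t _; apply: finitely_covered_one => W1 W2.
  move=> [[hW1 _] [f1 [f1a f1P f1e]]] [[hW2 _] [f2 [f2a f2P f2e]]].
  (* With the same [t], following the inverse of [f1] by [f2] fixes every vertex and carries [P W1]
     to [P W2]. *)
  have [f1' [f1'a f1K f1'K]] := aut_inv f1a.
  have [h ha hE] := aut_comp f2a f1'a.
  have hf : fixes_idem h.
    by split=> // w; rewrite hE -{1}(f1e w) f1K f2e.
  exists h => //; apply: (preim_fixes hf hW1 hW2).
  rewrite -/(P W1) -/(P W2) -f1P -f2P -limg_comp; apply: eq_in_limg => x _.
  by rewrite comp_lfunE hE f1K.
apply: finite_union_covered => [A A' grA [f fa ->]|]; first exact: AlgGr_aut.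
pose C (i : bool * (V * V)) A := if i.1
  then forall x, (x \in A) = (chi i.2.1 x == chi i.2.2 x)
  else exists2 W, hyperplane i.2.1 i.2.2 W &
         aut_orbit (arrow_part i.2.1 i.2.2 @^-1: W)%VS A.
apply: (@finitely_covered_cases _ _ _ (enum {: bool * (V * V)}) C).
  move=> A /codim1_class[u [v [A_uv|A_W]]].
    by exists (true, (u, v)); rewrite ?mem_enum.
  by exists (false, (u, v)); rewrite ?mem_enum.
move=> [[] [u v]] _; rewrite /C /=.
  apply: finitely_covered_one => A A' [_ AE] [_ A'E].
  have -> : A' = A by apply/vspaceP => x; rewrite AE A'E.
  exact: aut_orbit_refl.
case: (eqVneq (arrow_space (e u) (e v)) 0%VS) => [U0|/eqP/fin[s sE]].
  (* The zero space has no hyperplane, so this case is empty. *)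
  apply: finitely_covered_one => A A' [_ [W [_ +] _]].
  by rewrite U0 dimv0.
apply: (@finitely_covered_cases _ _ _ s (fun W A =>
  aut_orbit (arrow_part u v @^-1: W)%VS A)).
  move=> A [_ [W hW AW]]; have /sE[W0 W0s [f ff WE]] := hW; exists W0 => //.
  apply: aut_orbit_trans AW; have [fa _] := ff; exists f => //.
  (* The listed representatives are hyperplanes themselves, because each lies in its own orbit. *)
  have hW0 : hyperplane u v W0.
    by apply/sE; exists W0 => //; apply: idem_orbit_refl.
  by rewrite WE; have [] := fixes_preim ff hW0.
move=> W _; apply: finitely_covered_one => A A' [_ AW] [_ A'W].
exact: aut_orbit_trans (aut_orbit_sym AW) A'W.
Qed.

End BasicAlgebra.

(** * The case of kQ/I *)

Theorem theorem1p3 (k : closedFieldType) (Q : quiver)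
    (I : pathalg k Q -> Prop) (B : falgType k)
    (pi : {linear pathalg k Q -> B}) :
  admissible I ->
  is_quotient_by I pi ->
  finite_union_of_orbits (@aut_orbit k B) (@AlgGr k B (\dim {:B} - 1)%N)
  <->
  (forall u v : vertex Q,
     arrow_space (vertex_idem pi u) (vertex_idem pi v) <> 0%VS ->
     finite_union_of_orbits (@HB_orbit k B Q pi)
       (hyperplane_of (arrow_space (vertex_idem pi u) (vertex_idem pi v)))).
Proof.
move=> admI quoI.
have [chi [chi_idem chiM chi_nil]] := quotient_characters admI quoI.
have idemM := quotient_idemM quoI; have idem1 := quotient_idem1 quoI.
have chi1 u : chi u 1 = 1.
  rewrite -idem1 linear_sum (bigD1 u) //= chi_idem eqxx big1 ?addr0 // => w ne.
  by rewrite chi_idem (negbTE ne).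
have memJ := jacobson_chars chiM chi1 chi_nil.
apply: (@codim1_subalg_finite k B (vertex Q) (vertex_idem pi)
  (fun u x => chi u x)) => //.
- by move=> u a x y; rewrite linearP.
- by move=> x /memJ/chi_nil.
Qed.
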